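(* Assume that there exists a strictly increasing sequence of real numbers $\{\alpha_j\}_{j=0}^n$ such that, for every $j\in\{0,\dots,n\}$, $(-1)^jg>0$ and $(-1)^jh$ is nonincreasing over the interval $\left(\alpha_j-\frac{aT}{2},\alpha_j+\frac{aT}{2}\right)$. Then, for any continuous $T$-periodic function $p:\mathbb{T}\to\mathbb{R}$ with mean value zero, i.e. $\frac1T\int_0^T p(t)\,\Delta t=0$, the equation $$(\varphi(x^{\Delta}(t)))^{\Delta}+h(x(t))x^{\Delta}(t)+g(x(t-r))=p(t),\qquad t\in\mathbb{T},$$ has at least $n$ different $T$-periodic solutions.
   Context: Setting: $T>0$ and $r\ge 0$ are real numbers. $\mathbb{T}\subset\mathbb{R}$ is a time scale (a nonempty closed subset of $\mathbb{R}$) that is $T$-periodic, i.e. $\mathbb{T}+T=\mathbb{T}$, with $\mathbb{T}-r\subset\mathbb{T}$ and $0\in\mathbb{T}$. $x^\Delta$ denotes the usual (Hilger) delta derivative on $\mathbb{T}$ and $\int\cdot\,\Delta t$ the usual delta integral on $\mathbb{T}$. $\varphi:(-a,a)\to\mathbb{R}$ is an increasing homeomorphism with $0<a<+\infty$ and $\varphi(0)=0$; $h,g:\mathbb{R}\to\mathbb{R}$ are continuous functions. $C^1_T$ is the Banach space of all continuous $T$-periodic functions $x:\mathbb{T}\to\mathbb{R}$ that are $\Delta$-differentiable with continuous $\Delta$-derivative. A $T$-periodic solution of the equation is a function $x\in C^1_T$ with $|x^\Delta(t)|<a$ for all $t\in\mathbb{T}$ (so that $\varphi(x^\Delta)$ is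 defined), such that $\varphi(x^\Delta)$ is of class $C^1$ (i.e. $\Delta$-differentiable with continuous $\Delta$-derivative), and satisfying the equation for all $t\in\mathbb{T}$. Solutions are different if they are different as functions on $\mathbb{T}$. *)

(* Defs.v *)
From HB Require Import structures.
From mathcomp Require Import all_boot all_order all_algebra.
From mathcomp Require Import all_classical all_reals all_analysis.

Set Implicit Arguments.
Unset Strict Implicit.
Unset Printing Implicit Defensive.

Import Order.TTheory GRing.Theory Num.Theory.
Import numFieldNormedType.Exports.

Local Open Scope classical_set_scope.
Local Open Scope ring_scope.

(* Functions on a time scale [TS : set R] are represented by total functions
   [R -> R]; every notion below only depends on their values on [TS]. *)

Definition time_scale (R : realType) (TS : set R) : Prop :=
  TS !=set0 /\ closed TS.

Definition periodic_time_scale (R : realType) (T : R) (TS : set R) : Prop :=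
  [set t + T | t in TS] = TS.

Definition periodic_on (R : realType) (T : R) (TS : set R) (f : R -> R) : Prop :=
  forall t, TS t -> f (t + T) = f t.

(* The convention inf set0 = sup TS and the exclusion of a left-scattered
   maximum (the set usually written TS^kappa) are omitted: a periodic time scale
   with T > 0 is unbounded above, so TS^kappa = TS and the infimum below is
   taken over a nonempty set. *)
Definition forward_jump (R : realType) (TS : set R) (t : R) : R :=
  inf [set s | TS s /\ t < s].

Definition is_delta_deriv (R : realType) (TS : set R) (f : R -> R) (t l : R) :
    Prop :=
  forall e : R, 0 < e -> exists2 d : R, 0 < d &
    forall s : R, TS s -> `|s - t| < d ->
      `|f (forward_jump TS t) - f s - l * (forward_jump TS t - s)|
        <= e * `|forward_jump TS t - s|.

Definition delta_derivable (R : realType) (TS : set R) (f : R -> R) (t : R) :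
    Prop :=
  exists l, is_delta_deriv TS f t l.

(* Total operator, meaningful only where [f] is delta-differentiable. *)
Definition delta_deriv (R : realType) (TS : set R) (f : R -> R) (t : R) : R :=
  xget 0 [set l | is_delta_deriv TS f t l].

Definition delta_C1 (R : realType) (TS : set R) (f : R -> R) : Prop :=
  (forall t, TS t -> delta_derivable TS f t) /\
  {within TS, continuous (delta_deriv TS f)}.

Definition is_delta_antiderivative (R : realType) (TS : set R)
    (F f : R -> R) : Prop :=
  forall t, TS t -> is_delta_deriv TS F t (f t).

(* Cauchy delta integral: F b - F a for an antiderivative F of f. It is
   meaningful only if an antiderivative exists, which is the case for every
   continuous f. *)
Definition delta_integral (R : realType) (TS : set R) (f : R -> R) (a b : R) :
    R :=
  xget 0 [set v | exists2 F, is_delta_antiderivative TS F f & v = F b - F a].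

Definition C1_periodic (R : realType) (T : R) (TS : set R) (x : R -> R) : Prop :=
  [/\ {within TS, continuous x}, periodic_on T TS x & delta_C1 TS x].

(* Only the values of [phi] on ]-a, a[ are relevant. *)
Definition increasing_homeomorphism (R : realType) (a : R) (phi : R -> R) :
    Prop :=
  [/\ forall u v, u \in `]- a, a[ -> v \in `]- a, a[ -> u < v -> phi u < phi v,
      {within `]- a, a[, continuous phi} &
      exists psi : R -> R,
        [/\ forall y, psi y \in `]- a, a[,
            forall u, u \in `]- a, a[ -> psi (phi u) = u,
            forall y, phi (psi y) = y &
            continuous psi]].

Definition periodic_solution (R : realType) (T r a : R) (TS : set R)
    (phi h g p x : R -> R) : Prop :=
  [/\ C1_periodic T TS x,
      forall t, TS t -> `|delta_deriv TS x t| < a,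
      delta_C1 TS (fun t => phi (delta_deriv TS x t)) &
      forall t, TS t ->
        delta_deriv TS (fun s => phi (delta_deriv TS x s)) t
          + h (x t) * delta_deriv TS x t + g (x (t - r)) = p t].

(* Main.v *)
Require Import Defs.
From HB Require Import structures.
From mathcomp Require Import all_boot all_order all_algebra zify ring lra.
Set Implicit Arguments.
Unset Strict Implicit.
Unset Printing Implicit Defensive.

(** Write v for phi(x^Delta), psi for the inverse of phi, and c for x(0). A
    periodic solution is the same thing as a pair (v, c) such that, with
    x(t) = c + int_0^t psi(v),
      v(t) = v(0) + int_0^t (p - h(x) psi(v) - g(x(. - r))),
      int_0^T psi(v) = 0   and   int_0^T (p - h(x) psi(v) - g(x(. - r))) = 0.
    One solution is found for each pair of consecutive values
    alpha_i < alpha_(i+1), with c strictly between them; solutions obtained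
    from different pairs then differ at the point 0.

    The two scalar conditions are built into a fixed-point problem ([step]):
    the number v(0) is displaced by minus the first integral and clamped to a
    large interval [-M, M], and c is displaced by -(-1)^i times the second
    integral and clamped to [alpha_i, alpha_(i+1)]. At a fixed point a
    displacement is zero unless it pushes outwards at an end of the interval
    ([clamp_fixed]). For v(0) = M all values of v are nonnegative, so the
    displacement is not outwards; likewise for -M. Hence x is T-periodic. If
    c = alpha_j, then x stays within bT/2 of alpha_j for some b < a, because it
    returns to alpha_j after a period with slopes bounded by b
    ([transport_oscillation]); there (-1)^j g is positive and (-1)^j h is
    nonincreasing. The integral of h(x) x^Delta need not vanish on a time scale,
    but it has a sign: if f is nonincreasing, its primitive F is concave, so
    F(x)^Delta <= f(x) x^Delta, and integrating over a period gives
    0 <= int f(x) x^Delta ([transport_ge0]). So (-1)^j times the second integral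
    is negative ([balance_sign]), the displacement of c points inwards at both
    ends, and the second condition holds with c in the open interval.

    The fixed point comes from a Schauder theorem for bounded maps whose range
    is approximated by finitely many coordinates ([schauder]). It rests on
    Brouwer's theorem, which is obtained from Scarf's combinatorial lemma
    ([colourful_room]): no triangulation is needed, only several total orders on
    a finite set and a parity count.

    Integrals are taken over the real line after composition with the map that
    sends s to the last point of the time scale not after s ([floor_ts]). The
    integral itself ([prim]) is the limit of Riemann sums along an ultrafilter
    on nat. It is additive, monotone and invariant under the period, and it is
    defined for all bounded functions, so the step functions that occur in the
    finite-dimensional approximations need no measurability argument. For
    functions continuous on the time scale it is a delta antiderivative
    ([is_delta_deriv_prim]), and a monotonicity criterion on the time scale
    ([ts_nondecreasing]) shows that antiderivatives are unique up to a constant,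
    which identifies it with the delta integral ([delta_integralE]). *)

(** * Scarf's combinatorial lemma *)

Section Dominated.
Variables (V I : finType) (rk : I -> V -> nat).
Hypothesis rk_inj : forall i, injective (rk i).

(** Scarf's primitive sets, without the condition on their cardinality: no
    element beats all the minima of A at the same time. *)
Definition dominated (A : {set V}) :=
  [forall y, exists i, [forall x in A, rk i y <= rk i x]].

Lemma dominatedP (A : {set V}) :
  reflect (forall y, exists i, forall x, x \in A -> rk i y <= rk i x)
          (dominated A).
Proof.
apply: (iffP forallP) => H y.
  by have /existsP[i /forall_inP Hi] := H y; exists i.
by have [i Hi] := H y; apply/existsP; exists i; apply/forall_inP.
Qed.

Lemma dominatedS (A B : {set V}) :
  A \subset B -> dominated B -> dominated A.
Proof.
move=> /subsetP sAB /dominatedP dB; apply/dominatedP => y.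
by have [i Hi] := dB y; exists i => x /sAB; exact: Hi.
Qed.

Definition minima (A : {set V}) (m : I -> V) :=
  forall i, m i \in A /\ (forall x, x \in A -> rk i (m i) <= rk i x).

Lemma minima_exist (A : {set V}) : A != set0 -> exists m, minima A m.
Proof.
move=> /set0Pn[a aA].
suff /fin_all_exists[m] : forall i, exists x,
    x \in A /\ (forall y, y \in A -> rk i x <= rk i y) by exists m.
move=> i.
by exists [arg min_(x < a in A) rk i x]; case: (arg_minnP (rk i) aA).
Qed.

(** Domination of x itself gives an order for which x is the minimum. *)
Lemma minima_onto (A : {set V}) m x :
  minima A m -> dominated A -> x \in A -> exists i, m i = x.
Proof.
move=> mA /dominatedP/(_ x)[i Hi] xA; exists i; apply: (@rk_inj i).
have [mi mle] := mA i.
by apply/eqP; rewrite eqn_leq mle // Hi.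
Qed.

End Dominated.

(** Exactly one value is lost, so removing either of two colliding indices
    leaves an injective map; any other collision would survive one of the
    removals. *)
Lemma single_collision (I : finType) (V : finType) (f : I -> V) :
  #|[set f i | i : I]|.+1 = #|I| ->
  exists i j, [/\ i != j, f i = f j &
    forall k l, k != l -> f k = f l -> k = i \/ k = j].
Proof.
move=> fI.
have : ~~ injectiveb f.
  apply/negP => /injectiveP finj.
  by move: fI; rewrite card_imset // => /eqP; rewrite eqn_leq ltnn.
move=> /injectivePn[i [j ij fij]].
have aux a b : a != b -> f a = f b -> {in [set~ a] &, injective f}.
  move=> ab fab; apply/imset_injP; rewrite cardsC1 -fI /=.
  apply/eqP; congr #|pred_of_set _|; apply/eqP.
  rewrite eqEsubset; apply/andP; split; apply/subsetP => y /imsetP[x xa ->].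
    by apply: imset_f.
  have [->|xNa] := eqVneq x a; first by rewrite fab imset_f // !inE eq_sym.
  by rewrite imset_f // !inE.
exists i, j; split => // k l kl fkl.
have [->|ki] := eqVneq k i; first by left.
have [->|kj] := eqVneq k j; first by right.
have li : l = i.
  apply/eqP/negPn/negP => li; move/eqP: kl; apply.
  by apply: (aux _ _ ij fij); rewrite ?inE.
have lj : l = j.
  apply/eqP/negPn/negP => lj; move/eqP: kl; apply.
  have ji : j != i by rewrite eq_sym.
  by apply: (aux _ _ ji (esym fij)); rewrite ?inE.
by move: ij; rewrite -li -lj eqxx.
Qed.

(** Each index i has a slack element [s i]: least for the order i and above
    every element that is not a slack for the other orders. A dominated set with
    as many elements as there are orders is a room, and one with an element less
    is a door. The slacks make every door lie in two rooms, except the doors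
    formed by all slacks but one, which lie in a single room. *)
Section Scarf.
Variables (V I : finType) (rk : I -> V -> nat) (s : I -> V) (c : V -> I).
Hypothesis rk_inj : forall i, injective (rk i).
Hypothesis rk_slack : forall i y, rk i (s i) <= rk i y.
Hypothesis rk_top : forall i j y,
  j != i -> y \notin codom s -> rk i y < rk i (s j).
Variable v0 : V.
Hypothesis v0P : v0 \notin codom s.
Hypothesis c_slack : forall i, c (s i) = i.
Hypothesis I_gt1 : 1 < #|I|.

Let dom := dominated rk.

Definition extensions (t : {set V}) := [set z | (z \notin t) && dom (z |: t)].

(** The candidates for becoming the minimum of index k when added to a door. *)
Definition above (m : I -> V) k :=
  [set y | [forall l, (l != k) ==> (rk l (m l) < rk l y)]].

Lemma aboveP m k y :
  reflect (forall l, l != k -> rk l (m l) < rk l y) (y \in above m k).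
Proof.
rewrite inE; apply: (iffP forallP) => H l.
  by move/implyP: (H l).
by apply/implyP/H.
Qed.

Lemma door_collision t m : minima rk t m -> dom t -> #|t|.+1 = #|I| ->
  exists i j, [/\ i != j, m i = m j &
    forall k l, k != l -> m k = m l -> k = i \/ k = j].
Proof.
move=> mt dt ct; apply: single_collision; rewrite -ct.
congr _.+1; congr #|pred_of_set _|; apply/setP => x; apply/imsetP/idP.
  by move=> [i _ ->]; case: (mt i).
by move=> xt; have [i <-] := minima_onto rk_inj mt dt xt; exists i.
Qed.

(** In a door t exactly two indices i and j share their minimum. If t with z
    is a room, then all indices have different minima, so z takes over one of
    i and j, and it is the largest candidate for it, because a larger one
    would beat every minimum. Conversely the largest candidate never breaks
    domination. *)
Lemma extensionsP t m i j z : minima rk t m -> dom t -> #|t|.+1 = #|I| ->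
  i != j -> m i = m j ->
  (forall k l, k != l -> m k = m l -> k = i \/ k = j) ->
  reflect (exists2 k, k = i \/ k = j &
             z \in above m k /\
             (forall y, y \in above m k -> rk k y <= rk k z))
          (z \in extensions t).
Proof.
move=> mt dt ct ij mij uij; rewrite inE; apply: (iffP andP).
  move=> [zt dzt].
  have [m' mm'] : exists m', minima rk (z |: t) m'.
    by apply: minima_exist; apply/set0Pn; exists z; rewrite setU11.
  have [k mk] := minima_onto rk_inj mm' dzt (setU11 z t).
  have czt : #|z |: t| = #|I| by rewrite cardsU1 zt -ct.
  have m'inj : injective m'.
    apply/injectiveP; rewrite /injectiveb /dinjectiveb; apply/card_uniqP.
    rewrite size_map -cardE -[RHS]czt; apply/eq_card => x; apply/mapP/idP.
      by move=> [l _ ->]; case: (mm' l).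
    move=> xzt; have [l <-] := minima_onto rk_inj mm' dzt xzt.
    by exists l => //; rewrite mem_enum.
  have m'm l : l != k -> m' l = m l.
    move=> lk; have [m'l m'le] := mm' l; have [ml mle] := mt l.
    have m'lt : m' l \in t.
      move: m'l; rewrite in_setU1 => /predU1P[|//].
      by rewrite -mk => /m'inj lk'; rewrite lk' eqxx in lk.
    apply: (@rk_inj l); apply/eqP; rewrite eqn_leq mle // m'le //.
    by rewrite in_setU1 ml orbT.
  have kij : k = i \/ k = j.
    have [->|ki] := eqVneq k i; first by left.
    have [->|kj] := eqVneq k j; first by right.
    have : m' i = m' j by rewrite !m'm // eq_sym.
    by move=> /m'inj ij'; rewrite ij' eqxx in ij.
  have zle l x : x \in z |: t -> rk l (m' l) <= rk l x by case: (mm' l) => _; apply.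
  exists k => //; split.
    apply/aboveP => l lk; rewrite ltn_neqAle -m'm // zle ?setU11 // andbT.
    by rewrite (inj_eq (@rk_inj l)) -mk (inj_eq m'inj).
  move=> y /aboveP yk; rewrite leqNgt; apply/negP => zy.
  have /dominatedP/(_ y)[l ly] := dzt.
  have := ly (m' l) (mm' l).1; rewrite leqNgt => /negP; apply.
  have [->|lk] := eqVneq l k; first by rewrite mk.
  by rewrite m'm // yk.
move=> [k kij [/aboveP zk zmax]].
have [k' k'k mk] : exists2 k', k' != k & m k' = m k.
  by case: kij => ->; [exists j|exists i] => //; rewrite eq_sym.
have zt : z \notin t.
  apply/negP => zt; have [l ml] := minima_onto rk_inj mt dt zt.
  have [lk|lk] := eqVneq l k.
    by have := zk k' k'k; rewrite mk -lk ml ltnn.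
  by have := zk l lk; rewrite ml ltnn.
split=> //; apply/dominatedP => y.
have [/existsP[l /forall_inP Hl]|/existsPn N] :=
    boolP [exists l, [forall x in z |: t, rk l y <= rk l x]].
  by exists l.
have lt_y l : rk l (m l) < rk l y \/ (l = k /\ rk k z < rk k y).
  have /forall_inPn[x xzt] := N l; rewrite -ltnNge => xy.
  move: xzt; rewrite in_setU1 => /predU1P[xz|xt]; last first.
    by left; apply: leq_ltn_trans xy; apply: (mt l).2.
  have [lk|lk] := eqVneq l k; first by right; rewrite -lk -xz.
  by left; apply: ltn_trans xy; rewrite xz; apply: zk.
have yk : y \in above m k.
  by apply/aboveP => l lk; case: (lt_y l) => // -[lk']; rewrite lk' eqxx in lk.
have /dominatedP/(_ y)[l Hl] := dt.
have := Hl (m l) (mt l).1; rewrite leqNgt.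
case: (lt_y l) => [->//|[lk]].
by rewrite ltnNge zmax.
Qed.

Lemma above_disjoint t m i j z : minima rk t m -> dom t -> i != j ->
  z \in above m i -> z \notin above m j.
Proof.
move=> mt dt ij /aboveP zi; apply/negP => /aboveP zj.
have /dominatedP/(_ z)[l Hl] := dt.
have := Hl (m l) (mt l).1; rewrite leqNgt => /negP; apply.
have [->|li] := eqVneq l i; first exact: zj.
exact: zi.
Qed.

Lemma above_max m k : above m k != set0 ->
  exists2 z, z \in above m k & forall y, y \in above m k -> rk k y <= rk k z.
Proof.
move=> /set0Pn[a aA]; exists [arg max_(x > a in above m k) rk k x];
by case: (arg_maxnP (rk k) aA).
Qed.

Lemma max_unique m k z z' : z \in above m k -> z' \in above m k ->
  (forall y, y \in above m k -> rk k y <= rk k z) ->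
  (forall y, y \in above m k -> rk k y <= rk k z') -> z = z'.
Proof.
by move=> zA z'A zm z'm; apply: (@rk_inj k); apply/eqP;
  rewrite eqn_leq zm // z'm.
Qed.

Definition boundary i := [set s j | j in [set~ i]].

Lemma s_inj : injective s. Proof. exact: can_inj c_slack. Qed.

Lemma s_boundary i j : (s j \in boundary i) = (j != i).
Proof. by rewrite mem_imset ?inE //; exact: s_inj. Qed.

Lemma card_boundary i : #|boundary i|.+1 = #|I|.
Proof. by rewrite card_imset ?cardsC1 ?prednK //; [exact: ltnW|exact: s_inj]. Qed.

Lemma boundary_dominated i : dom (boundary i).
Proof.
apply/dominatedP => y; have [/codomP[k ->]|yN] := boolP (y \in codom s).
  by exists k => x _.
exists i => x /imsetP[j]; rewrite !inE => ji ->.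
by apply/ltnW/rk_top.
Qed.

Lemma rk_lt_slack k z : z != s k -> rk k (s k) < rk k z.
Proof.
by move=> zk; rewrite ltn_neqAle rk_slack andbT (inj_eq (@rk_inj k)) eq_sym.
Qed.

(** The shared minimum is a slack s k, and the colliding indices are i and k.
    Nothing can replace it at k, whereas every element that is not a slack is
    a candidate at i. *)
Lemma card_extensions_boundary i : #|extensions (boundary i)| = 1.
Proof.
set t := boundary i.
have ct := card_boundary i; have dt := boundary_dominated i.
have [m mt] : exists m, minima rk t m.
  apply: minima_exist; rewrite -card_gt0 -ltnS ct.
  exact: I_gt1.
have ms l : l != i -> m l = s l.
  move=> li; apply: (@rk_inj l); apply/eqP; rewrite eqn_leq rk_slack andbT.
  by apply: (mt l).2; rewrite s_boundary.
have [k ki mi] : exists2 k, k != i & m i = s k.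
  by have /imsetP[k] := (mt i).1; rewrite !inE => ki ->; exists k.
have [i1 [j1 [ij1 mij1 uij1]]] := door_collision mt dt ct.
have mik : m i = m k by rewrite mi ms.
have uik a b : a != b -> m a = m b -> a = i \/ a = k.
  move=> ab mab; have [ai|ai] := eqVneq a i; first by left.
  have [bi|bi] := eqVneq b i.
    right; apply: s_inj; rewrite -mi -(ms a) // mab bi //.
  by move: mab; rewrite !ms // => /s_inj ab'; rewrite ab' eqxx in ab.
have ik : i != k by rewrite eq_sym.
have ext z := extensionsP z mt dt ct ik mik uik.
have Mk : above m k = set0.
  apply/setP => y; rewrite [RHS]inE; apply/negP => /aboveP yM.
  have ys : y \notin codom s.
    apply/negP => /codomP[l yl].
    have [li|li] := eqVneq l i.
      by have := yM i ik; rewrite yl li ltnNge rk_slack.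
    have [lk|lk] := eqVneq l k.
      by have := yM i ik; rewrite mi yl lk ltnn.
    by have := yM l lk; rewrite yl ms // ltnn.
  by have := yM i ik; rewrite mi ltnNge ltnW // rk_top.
have [z zi zmax] : exists2 z, z \in above m i &
    forall y, y \in above m i -> rk i y <= rk i z.
  apply: above_max; apply/set0Pn; exists v0; apply/aboveP => l li.
  rewrite ms //; apply: rk_lt_slack; apply/negP => /eqP v0l.
  by move: v0P; rewrite v0l codom_f.
rewrite -(cards1 z); congr #|pred_of_set _|; apply/setP => y; rewrite [RHS]inE.
apply/ext/eqP => [[l [->|->] []]|->].
- by move=> yM ymax; apply: max_unique ymax zmax.
- by rewrite Mk inE.
- by exists i; [left|].
Qed.

(** Both colliding indices have a candidate, namely their own slack; this
    could fail only if the minimum for some order were the slack of another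
    index, which forces t to consist of slacks. *)
Lemma card_extensions t : dom t -> #|t|.+1 = #|I| ->
  (forall i, t <> boundary i) -> #|extensions t| = 2.
Proof.
move=> dt ct tN.
have [m mt] : exists m, minima rk t m.
  by apply: minima_exist; rewrite -card_gt0 -ltnS ct.
have [i [j [ij mij uij]]] := door_collision mt dt ct.
have ext z := extensionsP z mt dt ct ij mij uij.
have Mk k : (exists2 k', k' != k & m k' = m k) -> above m k != set0.
  move=> [k' k'k mk']; apply/set0Pn; exists (s k); apply/aboveP => l lk.
  have kl : k != l by rewrite eq_sym.
  have [/codomP[a ma]|mN] := boolP (m l \in codom s); last exact: rk_top.
  have [al|al] := eqVneq a l.
    by rewrite ma al rk_lt_slack // (inj_eq s_inj).
  exfalso; apply: (tN l); apply/eqP; rewrite eqEcard -ltnS card_boundary ct leqnn.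
  rewrite andbT; apply/subsetP => x xt.
  have [/codomP[b xb]|xN] := boolP (x \in codom s); last first.
    by have := (mt l).2 x xt; rewrite ma leqNgt rk_top.
  rewrite xb s_boundary; apply/negP => /eqP bl.
  have := (mt l).2 x xt; rewrite xb bl ma leqNgt rk_lt_slack //.
  by rewrite (inj_eq s_inj).
have [zi ziM zimax] : exists2 z, z \in above m i &
    forall y, y \in above m i -> rk i y <= rk i z.
  by apply: above_max; apply: Mk; exists j; rewrite // eq_sym.
have [zj zjM zjmax] : exists2 z, z \in above m j &
    forall y, y \in above m j -> rk j y <= rk j z.
  by apply: above_max; apply: Mk; exists i.
have zij : zi != zj.
  apply/negP => /eqP zz; have := above_disjoint mt dt ij ziM.
  by rewrite zz zjM.
rewrite -[RHS]/(true.+1) -zij -cards2; congr #|pred_of_set _|.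
apply/setP => y; rewrite [RHS]inE !in_set1.
apply/ext/orP => [[l [->|->] []]|[/eqP->|/eqP->]].
- by move=> yM ymax; left; apply/eqP; apply: max_unique ymax zimax.
- by move=> yM ymax; right; apply/eqP; apply: max_unique ymax zjmax.
- by exists i; [left|].
- by exists j; [right|].
Qed.

Definition rooms := [set r | dom r && (#|r| == #|I|)].

Definition doors i :=
  [set t | [&& dom t, #|t|.+1 == #|I| & c @: t == [set~ i]]].

Lemma card_rooms_of_door (t : {set V}) : #|t|.+1 = #|I| ->
  #|[set r in rooms | t \subset r]| = #|extensions t|.
Proof.
move=> ct; rewrite -(card_in_imset (f := fun z => z |: t)).
  congr #|pred_of_set _|; apply/setP => r; rewrite !inE.
  apply/idP/imsetP => [/andP[/andP[dr /eqP cr] tr]|[z]].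
    have /cards1P[z rz] : #|r :\: t| == 1.
      by rewrite cardsD (setIidPr tr) cr -ct subSnn.
    have zrt : z \in r :\: t by rewrite rz set11.
    have rE : r = z |: t by rewrite -rz setUC -{1}(setIidPr tr) setID.
    by move: zrt; rewrite inE => /andP[zt _]; exists z => //; rewrite inE zt -rE.
  rewrite inE => /andP[zt dz] ->; rewrite dz cardsU1 zt -ct eqxx /=.
  exact: subsetUr.
move=> z z'; rewrite !inE => /andP[zt _] /andP[z't _] zz'.
have : z \in z' |: t by rewrite -zz' setU11.
by rewrite in_setU1 (negbTE zt) orbF => /eqP.
Qed.

(** The doors that carry all colours but i include a single boundary door,
    because the slacks carry their own index as colour. *)
Lemma odd_door_sum i :
  odd (\sum_(t in doors i) #|[set r in rooms | t \subset r]|).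
Proof.
have bd : boundary i \in doors i.
  rewrite inE boundary_dominated card_boundary eqxx /=.
  apply/eqP/setP => k; apply/imsetP/idP.
    by move=> [x /imsetP[j ji ->] ->]; rewrite c_slack.
  by move=> ki; exists (s k); rewrite ?c_slack // imset_f.
rewrite (bigD1 _ bd) /= card_rooms_of_door ?card_boundary //.
rewrite card_extensions_boundary oddD /=.
apply: (big_ind (fun n => ~~ odd n)) => // [x y|t].
  by rewrite oddD => /negbTE -> /negbTE ->.
move=> /andP[tD tb].
have : t \in doors i by [].
rewrite inE => /and3P[dt /eqP ct /eqP tc].
rewrite card_rooms_of_door // card_extensions // => j tj.
move: tb; rewrite tj => /negP; apply; apply/eqP; congr boundary; apply/eqP.
have : i \notin c @: t by rewrite tc !inE eqxx.
apply: contraR => ji; rewrite tj; apply/imsetP; exists (s i).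
  by rewrite s_boundary eq_sym.
by rewrite c_slack.
Qed.

(** A door with all colours but i inside a room that is not colourful leaves
    out an element whose colour occurs again in the door; leaving out the
    other element of that colour gives the only other such door. *)
Lemma even_doors_of_room i (r : {set V}) : r \in rooms -> c @: r != [set: I] ->
  ~~ odd #|[set t in doors i | t \subset r]|.
Proof.
rewrite inE => /andP[dr /eqP cr] ncol; set E := (X in #|pred_of_set X|).
have [->|/set0Pn[t tE]] := eqVneq E set0; first by rewrite cards0.
have Einj t' : t' \in E -> {in t' &, injective c}.
  rewrite inE inE => /andP[/and3P[_ /eqP ct' /eqP tc'] _].
  by apply/imset_injP; rewrite tc' cardsC1 -ct'.
have EE t' : t' \in E -> exists2 x, x \in r & t' = r :\ x.
  rewrite inE inE => /andP[/and3P[_ /eqP ct' _] t'r].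
  have /cards1P[x rx] : #|r :\: t'| == 1.
    by rewrite cardsD (setIidPr t'r) cr -ct' subSnn.
  have : x \in r :\: t' by rewrite rx set11.
  rewrite inE => /andP[_ xr]; exists x => //.
  by rewrite -rx setDDr setDv set0U (setIidPr t'r).
have [x xr tx] := EE _ tE.
have := tE; rewrite inE inE => /andP[/and3P[dt /eqP ct /eqP tc] tr].
have rE : r = x |: t by rewrite tx setD1K.
have [x' x't cx'] : exists2 x', x' \in t & c x = c x'.
  apply/imsetP; rewrite tc !inE; apply: contra ncol => /eqP cxi.
  by rewrite rE imsetU1 tc cxi setUCr.
have xt : x \notin t by rewrite tx !inE eqxx.
have xx' : x != x' by apply: contraNneq xt => ->.
have x'r : x' \in r by rewrite rE in_setU1 x't orbT.
have rr' : r :\ x != r :\ x'.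
  apply: contraNneq xt => rr'; by rewrite tx rr' !inE xx'.
suff -> : E = [set r :\ x; r :\ x'] by rewrite cards2 rr'.
apply/setP => t'; apply/idP/set2P => [t'E|].
  have [y yr t'y] := EE _ t'E.
  have [<-|yx] := eqVneq y x; first by left.
  have [<-|yx'] := eqVneq y x'; first by right.
  have : x = x' by apply: (Einj _ t'E) => //; rewrite t'y !inE eq_sym ?yx ?yx'.
  by move/eqP; rewrite (negbTE xx').
move=> [->|->]; first by rewrite -tx.
have dr' : dom (r :\ x') by apply: dominatedS dr; apply: subD1set.
rewrite inE inE subD1set andbT dr' /=.
have := cardsD1 x' r; rewrite x'r cr /= add1n => <-; rewrite eqxx /=.
rewrite -tc; apply/eqP/setP => k; apply/imsetP/imsetP => [[y]|[y yt ->]].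
  rewrite in_setD1 rE in_setU1 => /andP[yx' /predU1P[->|yt]] ->.
    by exists x'.
  by exists y.
have [->|yx'] := eqVneq y x'.
  by exists x; rewrite // in_setD1 xx'.
by exists y; rewrite // in_setD1 yx' rE in_setU1 yt orbT.
Qed.

(** Incidences between rooms and the doors carrying all colours but i are odd
    in number when counted by doors, and would be even when counted by rooms
    if no room were colourful. *)
Lemma colourful_room : exists r, [/\ dom r, #|r| = #|I| & c @: r = [set: I]].
Proof.
have [i _] : exists i : I, i \in I by apply/card_gt0P/ltnW.
have [/existsP[r]|/existsPn N] := boolP [exists r in rooms, c @: r == [set: I]].
  rewrite inE -andbA => /and3P[dr /eqP cr /eqP rc]; by exists r.
have := odd_door_sum i.
under eq_bigr do rewrite -sum1_card big_set.
under eq_bigr do rewrite big_mkcondr.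
rewrite exchange_big /= => oddS; exfalso; move: oddS; apply/negP.
apply: (big_ind (fun n => ~~ odd n)) => // [x y|r rR].
  by rewrite oddD => /negbTE -> /negbTE ->.
rewrite -big_mkcondr /=.
have := N r; rewrite rR /= => /(even_doors_of_room i rR).
by rewrite -sum1_card big_set.
Qed.

End Scarf.

(** * Clusters of grid points in a simplex *)

Section Grid.
Variables (I : finType) (l : nat).

Definition grid := {x : {ffun I -> 'I_l.+1} | \sum_i x i == l}.

Definition coord (x : grid) (i : I) : nat := val x i.

Lemma sum_coord x : \sum_i coord x i = l.
Proof. exact/eqP/(valP x). Qed.

Lemma gridP (f : I -> nat) : \sum_i f i = l ->
  exists x : grid, coord x =1 f.
Proof.
move=> fl; pose g := [ffun i => inord (f i) : 'I_l.+1].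
have gE i : g i = f i :> nat.
  by rewrite ffunE inordK // ltnS -fl (bigD1 i) //= leq_addr.
have gl : \sum_i g i == l by apply/eqP; rewrite -[RHS]fl; apply: eq_bigr => i _.
by exists (exist _ g gl) => i; rewrite /coord /= gE.
Qed.

(** Ties between coordinates are broken by the enumeration of the grid; the
    second summand holds the slacks. *)
Definition grid_rank (i : I) (v : grid + I) : nat :=
  match v with
  | inl x => (coord x i * #|{: grid}| + enum_rank x).+1
  | inr j => if j == i then 0 else (l.+1 * #|{: grid}| + enum_rank j).+1
  end.

Lemma coord_le x i : coord x i <= l.
Proof. by rewrite -ltnS ltn_ord. Qed.

Lemma grid_rank_le i x y : grid_rank i (inl x) <= grid_rank i (inl y) ->
  coord x i <= coord y i.
Proof.
rewrite /grid_rank ltnS => xy; rewrite leqNgt; apply/negP => yx.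
suff : grid_rank i (inl y) < grid_rank i (inl x) by rewrite ltnNge ltnS xy.
rewrite /grid_rank ltnS.
apply: (@leq_trans ((coord y i).+1 * #|{: grid}|)).
  by rewrite -addnS mulSn [leqRHS]addnC leq_add2l ltn_ord.
by rewrite (leq_trans (leq_mul yx (leqnn _))) // leq_addr.
Qed.

Lemma grid_rank_lt_slack i j x : j != i ->
  grid_rank i (inl x) < grid_rank i (inr j).
Proof.
move=> ji; rewrite /grid_rank (negbTE ji) ltnS.
apply: (@leq_trans ((coord x i).+1 * #|{: grid}|)).
  by rewrite -addnS mulSn [leqRHS]addnC leq_add2l ltn_ord.
apply: leq_trans (leq_addr _ _).
by rewrite leq_mul2r ltnS coord_le orbT.
Qed.

Lemma grid_rank_inj i : injective (grid_rank i).
Proof.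
move=> [x|j] [y|k] e.
- have xy : coord x i = coord y i.
    by apply/eqP; rewrite eqn_leq !grid_rank_le // e.
  move: e; rewrite /grid_rank xy => /succn_inj/addnI/val_inj/enum_rank_inj.
  by move=> ->.
- have [ki|ki] := eqVneq k i; first by move: e; rewrite /= ki eqxx.
  by have := grid_rank_lt_slack x ki; rewrite e ltnn.
- have [ji|ji] := eqVneq j i; first by move: e; rewrite /= ji eqxx.
  by have := grid_rank_lt_slack y ji; rewrite e ltnn.
move: e => /=; have [->|ji] := eqVneq j i; have [->|ki] := eqVneq k i => //.
by move=> /succn_inj/addnI/val_inj/enum_rank_inj ->.
Qed.

(** For a colourful room let C be the set of indices whose slack is absent.
    The minima over the room of the coordinates in C nearly exhaust the total
    l: otherwise raising each of them by one would leave room for a grid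
    point that beats all minima. Hence the coordinates in C of all grid
    points of the room are within #|I| of each other, and the other
    coordinates are at most #|I|. *)
Lemma colour_cluster (c : (I -> nat) -> I) : 1 < #|I| ->
  exists (z : I -> nat) (x : I -> I -> nat),
    [/\ \sum_k z k = l, forall i, \sum_k x i k = l,
        forall i k, x i k <= z k + #|I| /\ z k <= x i k + #|I| &
        forall i, c (x i) = i \/ z i <= #|I|].
Proof.
move=> I_gt1.
pose c' (v : grid + I) := match v with inl x => c (coord x) | inr j => j end.
have [i0 _] : exists i : I, i \in I by apply/card_gt0P/ltnW.
have [g0 _] : exists x : grid, coord x =1 (fun i => if i == i0 then l else 0).
  by apply: gridP; rewrite -big_mkcond big_pred1_eq.
have inlN (x : grid) : inl x \notin codom (@inr grid I).
  by apply/negP => /codomP[].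
have [r [dr cr rc]] : exists r : {set grid + I},
    [/\ dominated grid_rank r, #|r| = #|I| & c' @: r = [set: I]].
  apply: (@colourful_room _ _ grid_rank inr c' _ _ _ (inl g0)) => //.
  - exact: grid_rank_inj.
  - by move=> i v; rewrite /= eqxx.
  - move=> i j [x|k] ji; first by move=> _; apply: grid_rank_lt_slack.
    by rewrite codom_f.
have domg (y : grid) : exists2 i, inr i \notin r &
    forall x, inl x \in r -> coord y i <= coord x i.
  have /dominatedP/(_ (inl y))[i Hi] := dr; exists i.
    by apply/negP => /Hi; rewrite /= eqxx.
  by move=> x /Hi /grid_rank_le.
have colg i : inr i \notin r -> exists2 x, inl x \in r & c (coord x) = i.
  move=> ir; have : i \in c' @: r by rewrite rc inE.
  by move=> /imsetP[[x|j] xr ij]; [exists x|rewrite ij xr in ir].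
have [i1 i1r _] := domg g0.
have [z zr _] := colg i1 i1r.
have [m mr] : exists m : I -> grid, forall i, inl (m i) \in r /\
    (forall x, inl x \in r -> coord (m i) i <= coord x i).
  suff /fin_all_exists : forall i, exists m : grid, inl m \in r /\
    (forall x, inl x \in r -> coord m i <= coord x i) by [].
  move=> i; exists [arg min_(x < z | inl x \in r) coord x i].
  by case: (@arg_minnP _ z (fun x => inl x \in r) (coord^~ i) zr).
pose C i := inr i \notin r.
have lC : l < \sum_(i | C i) (coord (m i) i).+1.
  rewrite ltnNge; apply/negP => Cl.
  (* raise all minima by one and give what remains of l to the index i1 *)
  pose y i := if i == i1 then l - \sum_(j | C j && (j != i1)) (coord (m j) j).+1
              else if C i then (coord (m i) i).+1 else 0.
  have Cl' : \sum_(j | C j && (j != i1)) (coord (m j) j).+1 + (coord (m i1) i1).+1 <= l.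
    by apply: leq_trans Cl; rewrite [leqRHS](bigD1 i1) //= addnC.
  have [g gy] : exists g : grid, coord g =1 y.
    apply: gridP; rewrite (bigD1 i1) //= {1}/y eqxx.
    rewrite [X in _ + X](_ : _ = \sum_(j | C j && (j != i1)) (coord (m j) j).+1).
      by rewrite subnK // (leq_trans _ Cl') ?leq_addr.
    rewrite big_mkcondl; apply: eq_bigr => j /negbTE ji; rewrite /y ji.
    by [].
  have [i ir gi] := domg g.
  have := gi (m i) (mr i).1; rewrite leqNgt => /negP; apply.
  rewrite gy /y; have [->|_] := eqVneq i i1; last by rewrite /C /= ir.
  by rewrite ltn_subRL -addnS.
have CI : \sum_(i | C i) (coord (m i) i).+1 <= \sum_(i | C i) coord (m i) i + #|I|.
  under eq_bigr do rewrite -addn1.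
  by rewrite big_split /= leq_add2l sum1_card max_card.
have bnd (x : grid) k : inl x \in r ->
    (if C k then coord (m k) k else 0) <= coord x k <=
    (if C k then coord (m k) k else 0) + #|I|.
  move=> xr; have mx j : coord (m j) j <= coord x j by apply: (mr j).2.
  have := leq_trans lC CI; rewrite -(sum_coord x) (bigID C) /= => {}lC.
  case: ifPn => Ck; rewrite ?mx /=.
    have : \sum_(i | C i && (i != k)) coord (m i) i <=
           \sum_(i | C i && (i != k)) coord x i by apply: leq_sum.
    move: lC; rewrite (bigD1 k) // [X in _ < X + _ -> _](bigD1 k) //=; lia.
  have : \sum_(i | C i) coord (m i) i <= \sum_(i | C i) coord x i by apply: leq_sum.
  move: lC; rewrite [X in _ + X < _ -> _](bigD1 k) //=; lia.
have [x xr] : exists x : I -> grid, forall i, inl (x i) \in r /\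
    (inr i \notin r -> c (coord (x i)) = i).
  suff /fin_all_exists : forall i, exists x : grid, inl x \in r /\
    (inr i \notin r -> c (coord x) = i) by [].
  move=> i; have [ir|ir] := boolP (inr i \in r); first by exists z.
  by have [x xr cx] := colg _ ir; exists x.
exists (coord z), (fun i => coord (x i)); split.
- exact: sum_coord.
- by move=> i; apply: sum_coord.
- move=> i k; have /andP[z1 z2] := bnd z k zr.
  have /andP[x1 x2] := bnd (x i) k (xr i).1.
  split; first by apply: leq_trans x2 _; rewrite leq_add2r.
  by apply: leq_trans z2 _; rewrite leq_add2r.
- move=> i; have [ir|/(xr i).2] := boolP (inr i \in r); last by left.
  by right; have := bnd z i zr; rewrite /C /= ir /= add0n.
Qed.

End Grid.
From mathcomp Require Import all_classical all_reals all_analysis.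
Import Order.TTheory GRing.Theory Num.Theory.
Import numFieldNormedType.Exports.
Local Open Scope classical_set_scope.
Local Open Scope ring_scope.

(** * Limits along an ultrafilter *)

(** A fixed ultrafilter finer than the filter of cofinite sets. All bounded
    sequences converge along it, which replaces every extraction of
    subsequences and provides the limit of Riemann sums of arbitrary bounded
    functions. *)
Definition nat_ultra : set_system nat :=
  projT1 (cid (ultraFilterLemma eventually_filter)).

Local Notation U := nat_ultra.

#[local] Instance nat_ultra_ultra : UltraFilter U.
Proof. by rewrite /U; case: cid => G []. Qed.

#[local] Instance nat_ultra_proper : ProperFilter U.
Proof. by case: nat_ultra_ultra. Qed.

Lemma nat_ultra_eventually (P : set nat) : \oo P -> U P.
Proof. by rewrite /U; case: cid => G /= [_ sG] /sG. Qed.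

Section UltraLimits.
Variable R : realType.
Implicit Types u v : nat -> R.

Definition ulim u : R := lim (u n @[n --> U]).

Lemma ulim_cvg u (M : R) : (\forall n \near U, `|u n| <= M) ->
  u n @[n --> U] --> ulim u.
Proof.
move=> uM; apply/cvg_ex.
have : (u n @[n --> U]) [set` `[- M, M]].
  by apply: filterS uM => n /=; rewrite in_itv /= ler_norml.
move=> /(@segment_compact R (- M) M _ _)[x [_ xcl]].
exists x => /= B Bx; have [//|UB] := in_ultra_setVsetC (u @^-1` B) nat_ultra_ultra.
by have [y []] := xcl (~` B) B UB Bx.
Qed.

Lemma cvg_ulim u l : u n @[n --> U] --> l -> ulim u = l.
Proof. exact: cvg_lim. Qed.

Lemma ulim_le u v l l' : u n @[n --> U] --> l -> v n @[n --> U] --> l' ->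
  (\forall n \near U, u n <= v n) -> l <= l'.
Proof.
move=> ul vl uv; rewrite -subr_ge0.
have vul : v n - u n @[n --> U] --> l' - l by apply: cvgB.
apply: (cvgr_to_ge vul).
by apply: filterS uv => n; rewrite subr_ge0.
Qed.

Lemma ulim_ge_cst u l (b : R) : u n @[n --> U] --> l ->
  (\forall n \near U, b <= u n) -> b <= l.
Proof. by move=> ul ub; apply: cvgr_to_ge ul ub. Qed.

Lemma ulim_norm_le u l (b : R) : u n @[n --> U] --> l ->
  (\forall n \near U, `|u n| <= b) -> `|l| <= b.
Proof.
by move=> ul ub; apply: cvgr_to_le (cvg_norm ul) ub.
Qed.

Lemma near_ultra_inv (e : R) : 0 < e -> \forall n \near U, n.+1%:R^-1 <= e.
Proof.
move=> e0; apply: nat_ultra_eventually.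
have /cvgr0Pnorm_le/(_ _ e0) := @cvg_harmonic R.
by apply: filterS => n; rewrite /harmonic /= ger0_norm ?invr_ge0.
Qed.

Lemma cvg_ultra_small u (l : R) v (M : R) : v n @[n --> U] --> l ->
  (forall n, `|u n - v n| <= M / n.+1%:R) -> u n @[n --> U] --> l.
Proof.
move=> vl uv; apply/cvgrPdist_le => e e0.
have M0 : 0 <= M.
  by have := le_trans (normr_ge0 _) (uv 0%N); rewrite divr1.
have e20 : 0 < e / 2 by rewrite divr_gt0.
have eM0 : 0 < e / 2 / (M + 1) by rewrite divr_gt0 // ltr_wpDl.
near=> n.
have -> : l - u n = (l - v n) - (u n - v n) by lra.
rewrite (le_trans (ler_normB _ _)) // [leRHS]splitr lerD //.
  by near: n; apply: cvgr_dist_le vl _ e20.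
rewrite (le_trans (uv n)) //.
have n_le : n.+1%:R^-1 <= e / 2 / (M + 1) by near: n; apply: near_ultra_inv.
rewrite (le_trans (ler_wpM2l M0 n_le)) // mulrCA ler_piMr ?(ltW e20) //.
by rewrite ler_pdivrMr ?mul1r ?lerDl// ltr_wpDl.
Unshelve. all: by end_near.
Qed.

Lemma cvg_ultra_eq u v (l : R) : (\forall n \near U, u n = v n) ->
  v n @[n --> U] --> l -> u n @[n --> U] --> l.
Proof.
move=> uv /cvgrPdist_le vl; apply/cvgrPdist_le => e /vl.
by apply: filterS2 uv => n ->.
Qed.

Lemma cvg_ultra_sum (I : Type) (r : seq I) (f : nat -> I -> R) (l : I -> R) :
  (forall i, f n i @[n --> U] --> l i) ->
  \sum_(i <- r) f n i @[n --> U] --> \sum_(i <- r) l i.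
Proof.
move=> fl; elim: r => [|i r IH].
  by under eq_fun do rewrite big_nil; rewrite big_nil; apply: cvg_cst.
by under eq_fun do rewrite big_cons; rewrite big_cons; apply: cvgD.
Qed.

End UltraLimits.

(** * Clamping to an interval *)

Section Clamp.
Variable R : realType.
Implicit Types lo hi x y : R.

Definition clamp lo hi x : R := Num.max lo (Num.min hi x).

Lemma clamp_itv lo hi x : lo <= hi -> lo <= clamp lo hi x <= hi.
Proof. by move=> lh; rewrite /clamp maxEle minEle; do 2 case: ifP; lra. Qed.

Lemma clamp_id lo hi x : lo <= x <= hi -> clamp lo hi x = x.
Proof.
by move=> /andP[lx xh]; rewrite /clamp (min_r xh) (max_r lx).
Qed.

Lemma clamp_mono lo hi : {homo clamp lo hi : y z / y <= z}.
Proof. by move=> y z yz; rewrite /clamp !maxEle !minEle; do 4 case: ifP; lra. Qed.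

Lemma clamp_lipschitz lo hi x y : `|clamp lo hi x - clamp lo hi y| <= `|x - y|.
Proof.
have := ler_norm (x - y); have := ler_norm (y - x); rewrite (distrC y).
by rewrite ler_norml /clamp !maxEle !minEle; do 4 case: ifP; lra.
Qed.

(** This turns an equation d = 0 on an interval into a fixed-point problem:
    the other two cases disappear once d is known not to point outwards at
    the ends. *)
Lemma clamp_fixed lo hi x d : lo < hi -> clamp lo hi (x + d) = x ->
  [\/ d = 0, 0 < d /\ x = hi | d < 0 /\ x = lo].
Proof.
move=> lh; rewrite /clamp maxEle minEle; have [d0|d0|->] := ltgtP d 0.
- by do 2 case: ifP; move=> ? ? ?; apply: Or33; split => //; lra.
- by do 2 case: ifP; move=> ? ? ?; apply: Or32; split => //; lra.
- by move=> _; apply: Or31.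
Qed.

Lemma cvg_clamp lo hi (T : Type) (F : set_system T) (FF : Filter F)
    (u : T -> R) (l : R) :
  u t @[t --> F] --> l -> clamp lo hi (u t) @[t --> F] --> clamp lo hi l.
Proof.
move=> ul; apply/cvgrPdist_le => e e0; move: ul => /cvgrPdist_le/(_ _ e0).
by apply: filterS => t; apply: le_trans; apply: clamp_lipschitz.
Qed.

End Clamp.

(** * The theorems of Brouwer and Schauder *)

Section BrouwerSimplex.
Variables (R : realType) (I : finType).
Implicit Types x y : I -> R.

Definition simplex : set (I -> R) :=
  [set x | (forall i, 0 <= x i) /\ \sum_i x i = 1].

Lemma simplex_le1 x i : simplex x -> x i <= 1.
Proof.
by move=> [x0 <-]; rewrite (bigD1 i) //= lerDl sumr_ge0.
Qed.

(** Colour a point x by an index i with x i <= f x i; one exists because both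
    families of coordinates have sum 1. The clusters of finer and finer grids
    converge to a point z with z <= f z in each coordinate, an index that is
    not met as a colour having z i = 0, and equality follows by summing.
    Continuity is stated along the ultrafilter because limits are taken
    there. *)
Lemma brouwer_simplex (f : (I -> R) -> I -> R) : (1 < #|I|)%N ->
  (forall x, simplex x -> simplex (f x)) ->
  (forall (x_ : nat -> I -> R) x, (forall n, simplex (x_ n)) -> simplex x ->
     (forall i, x_ n i @[n --> U] --> x i) ->
     forall i, f (x_ n) i @[n --> U] --> f x i) ->
  exists2 x, simplex x & forall i, f x i = x i.
Proof.
move=> I1 fS fC.
have [i0 _] : exists i : I, i \in I by apply/card_gt0P/ltnW.
pose pt n (g : I -> nat) i : R := (g i)%:R / n.+1%:R.
pose col n (g : I -> nat) : I :=
  odflt i0 [pick i | pt n g i <= f (pt n g) i].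
have n0 n : n.+1%:R != 0 :> R by rewrite pnatr_eq0.
have ptS n g : (\sum_i g i)%N = n.+1 -> simplex (pt n g).
  move=> gn; split => [i|]; first by rewrite divr_ge0.
  by rewrite -mulr_suml -natr_sum gn divff.
have colP n g : (\sum_i g i)%N = n.+1 ->
    pt n g (col n g) <= f (pt n g) (col n g).
  move=> gn; have gS := ptS _ _ gn; rewrite /col; case: pickP => //= N.
  have : \sum_i f (pt n g) i < \sum_i pt n g i.
    apply: ltr_sum => [|i _]; last by rewrite ltNge N.
    by apply/hasP; exists i0; rewrite ?mem_index_enum.
  by rewrite (fS _ gS).2 gS.2 ltxx.
have /choice[z_ /choice[x_ zx]] := fun n => @colour_cluster I n.+1 (col n) I1.
pose K : R := #|I|%:R.
pose z i := ulim (fun n => pt n (z_ n) i).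
have zc i : pt n (z_ n) i @[n --> U] --> z i.
  apply: (@ulim_cvg _ _ 1); near=> n; have [zn _ _ _] := zx n.
  have S := ptS _ _ zn; rewrite ger0_norm; last by case: S.
  exact: simplex_le1.
have xc j i : pt n (x_ n j) i @[n --> U] --> z i.
  apply: (@cvg_ultra_small _ _ _ _ K (zc i)) => n.
  have [_ _ xz _] := zx n; have [x1 x2] := xz j i.
  rewrite /pt -mulrBl normrM [X in _ * X]ger0_norm ?invr_ge0 //.
  rewrite ler_wpM2r ?invr_ge0 // ler_distl /K -natrD lerBlDr -natrD !ler_nat.
  by rewrite x1 x2.
have zS : simplex z.
  split => [i|].
    apply: ulim_ge_cst (zc i) _; near=> n; have [zn _ _ _] := zx n.
    by case: (ptS _ _ zn).
  have : \sum_i pt n (z_ n) i @[n --> U] --> \sum_i z i.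
    exact: cvg_ultra_sum.
  move=> /cvg_ulim <-; rewrite -[RHS](@cvg_ulim _ (fun=> 1)); last exact: cvg_cst.
  congr ulim; apply/funext => n; have [zn _ _ _] := zx n.
  by case: (ptS _ _ zn).
have fz i : z i <= f z i.
  have fx : f (pt n (x_ n i)) i @[n --> U] --> f z i.
    apply: fC => // n.
    by have [_ xn _ _] := zx n; apply: ptS.
  (* the error 2 #|I| / (n + 1) covers both cases of [colour_cluster] *)
  have zc' : pt n (x_ n i) i - (K + K) / n.+1%:R @[n --> U] --> z i.
    apply: (@cvg_ultra_small _ _ _ _ (K + K) (xc i i)) => n.
    by rewrite addrC addKr normrN ger0_norm // divr_ge0 // addr_ge0.
  apply: (ulim_le zc' fx); near=> n; have [zn xn xz c] := zx n.
  have [f0 f1] := fS _ (ptS _ _ (xn i)).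
  have [ci|zi] := c i.
    have := colP n (x_ n i) (xn i); rewrite ci; apply: le_trans.
    by rewrite gerBl divr_ge0 // addr_ge0.
  apply: le_trans (f0 i); rewrite subr_le0 /pt ler_wpM2r ?invr_ge0 //.
  rewrite /K -natrD ler_nat; have [+ _] := xz i i.
  by move=> /leq_trans; apply; rewrite leq_add2r.
exists z => // i; apply/eqP; rewrite eq_le fz andbT -subr_le0.
have [_ fz1] := fS _ zS.
have : \sum_j (f z j - z j) = 0 by rewrite sumrB fz1 zS.2 subrr.
rewrite (bigD1 i) //= => E.
suff : 0 <= \sum_(j | j != i) (f z j - z j) by lra.
by apply: sumr_ge0 => j _; rewrite subr_ge0.
Unshelve. all: by end_near.
Qed.

End BrouwerSimplex.

Lemma sum_option (V : nmodType) (J : finType) (F : option J -> V) :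
  \sum_o F o = F None + \sum_j F (Some j).
Proof.
rewrite (bigD1 None) //=; congr (_ + _).
rewrite (reindex_omap Some id) => [|[j|] //].
by apply: eq_bigl => j; rewrite /= eqxx.
Qed.

Section BrouwerCube.
Variables (R : realType) (J : finType) (B : R).
Hypothesis B0 : 0 < B.

Definition bounded_by (S : Type) (C : R) (u : S -> R) := forall s, `|u s| <= C.

(** The cube embeds in the simplex over [option J], the index None taking the
    remaining weight, and clamping retracts the simplex onto the cube. *)
Lemma brouwer_cube (f : (J -> R) -> J -> R) :
  (forall y, bounded_by B y -> bounded_by B (f y)) ->
  (forall (y_ : nat -> J -> R) y, (forall n, bounded_by B (y_ n)) ->
     bounded_by B y -> (forall j, y_ n j @[n --> U] --> y j) ->
     forall j, f (y_ n) j @[n --> U] --> f y j) ->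
  exists2 y, bounded_by B y & forall j, f y j = y j.
Proof.
move=> fB fC.
have [J0|J0] := posnP #|J|.
  have Jf (j : J) : False by have := fintype0 j; rewrite J0; apply.
  by exists (fun=> 0) => j.
pose K : R := #|J|%:R.
have K0 : 0 < K by rewrite ltr0n.
have BK0 : 0 < 2 * B * K by rewrite !mulr_gt0.
pose cube (x : option J -> R) j := clamp (- B) B (2 * B * K * x (Some j) - B).
pose bary (y : J -> R) (o : option J) : R :=
  if o is Some j then (y j + B) / (2 * B * K)
  else 1 - \sum_j (y j + B) / (2 * B * K).
have cubeB x : simplex x -> bounded_by B (cube x).
  by move=> _ j; rewrite ler_norml clamp_itv // ge0_cp ?(ltW B0).
have baryS y : bounded_by B y -> simplex (bary y).
  move=> yB; have y_ge j : 0 <= (y j + B) / (2 * B * K).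
    apply: divr_ge0 (ltW BK0); rewrite -lerBlDr sub0r.
    by have := yB j; rewrite ler_norml => /andP[].
  split; last by rewrite sum_option /= subrK.
  move=> [j|] //=; rewrite subr_ge0.
  apply: le_trans (_ : \sum_(j : J) K^-1 <= 1); last first.
    by rewrite sumr_const -mulr_natr mulVf ?gt_eqF.
  apply: ler_sum => j _; rewrite ler_pdivrMr // mulrCA mulVf ?gt_eqF // mulr1.
  by have := yB j; rewrite ler_norml => /andP[_ yj]; lra.
have [x xS fx] : exists2 x, simplex x & forall o, bary (f (cube x)) o = x o.
  apply: brouwer_simplex.
  - by rewrite card_option.
  - by move=> x xS; apply/baryS/fB/cubeB.
  move=> x_ x xnS xS xx.
  have fx j : f (cube (x_ n)) j @[n --> U] --> f (cube x) j.
    apply: fC => [n||{}j]; [exact: cubeB|exact: cubeB|].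
    by apply: cvg_clamp; apply: cvgB; [apply: cvgMr; exact: xx|exact: cvg_cst].
  have bx j : (f (cube (x_ n)) j + B) / (2 * B * K) @[n --> U] -->
              (f (cube x) j + B) / (2 * B * K).
    by apply: cvgMl; apply: cvgD => //; apply: cvg_cst.
  move=> [j|] /=; first exact: bx.
  by apply: cvgB; [exact: cvg_cst|exact: cvg_ultra_sum].
exists (cube x); first exact: cubeB.
move=> j; have cB := fB _ (cubeB _ xS) j.
rewrite {2}/cube -(fx (Some j)) /= mulrC divfK ?gt_eqF // addrK.
by rewrite clamp_id -?ler_norml.
Qed.

End BrouwerCube.

Section Schauder.
Variables (R : realType) (S : Type) (B : R) (f : (S -> R) -> S -> R).
Hypothesis B0 : 0 < B.
Hypothesis fB : forall u, bounded_by B u -> bounded_by B (f u).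

(** Compactness of the range of f: its elements are determined up to e by
    their values at finitely many points. *)
Definition finite_net := forall e : R, 0 < e ->
  exists (J : finType) (cell : S -> J) (pt : J -> S),
  forall u, bounded_by B u -> forall s, `|f u s - f u (pt (cell s))| <= e.

Definition uniform_cvg (u_ : nat -> S -> R) (u : S -> R) :=
  forall e : R, 0 < e -> \forall n \near U, forall s, `|u_ n s - u s| <= e.

Hypothesis fnet : finite_net.
Hypothesis fC : forall (u_ : nat -> S -> R) u,
  (forall n, bounded_by B (u_ n)) -> bounded_by B u -> uniform_cvg u_ u ->
  forall s, f (u_ n) s @[n --> U] --> f u s.

(** Functions constant on the cells of a net form a cube, on which Brouwer's
    theorem applies to the values of f at the chosen points. *)
Lemma approx_fixed_point (e : R) : 0 < e ->
  exists2 u, bounded_by B u & forall s, `|f u s - u s| <= e.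
Proof.
move=> /fnet[J [cell [pt Hnet]]].
have [y yB fy] : exists2 y, bounded_by B y &
    forall k, f (y \o cell) (pt k) = y k.
  apply: (@brouwer_cube _ _ B B0 (fun y k => f (y \o cell) (pt k))).
  - by move=> y yB k; apply: fB => s; apply: yB.
  move=> y_ y ynB yB yy k; apply: fC => [n s|s|]; [exact: ynB|exact: yB|].
  move=> e' e'0.
  have : \forall n \near U, forall k, `|y_ n k - y k| <= e'.
    by apply: filter_forall => i; apply: cvgr_distC_le (yy i) _ e'0.
  by apply: filterS => n H s; apply: H.
exists (y \o cell) => [s|s]; first exact: yB.
by rewrite /= -fy Hnet // => s'; apply: yB.
Qed.

(** The pointwise limit along the ultrafilter of approximate fixed points is
    a uniform limit, thanks to the finite nets. *)
Theorem schauder : exists2 u, bounded_by B u & forall s, f u s = u s.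
Proof.
have i0 n : 0 < n.+1%:R^-1 :> R by rewrite invr_gt0.
have /choice[u_ Hu] : forall n, exists u, bounded_by B u /\
    forall s, `|f u s - u s| <= n.+1%:R^-1.
  by move=> n; have [u] := approx_fixed_point (i0 n); exists u.
pose u s := ulim (u_^~ s).
have uc s : u_ n s @[n --> U] --> u s.
  by apply: (@ulim_cvg _ _ B); near=> n; apply: (Hu n).1.
have uB : bounded_by B u.
  by move=> s; apply: ulim_norm_le (uc s) _; near=> n; apply: (Hu n).1.
have unif : uniform_cvg u_ u.
  move=> e e0; have e60 : 0 < e / 9 by rewrite divr_gt0.
  have [J [cell [pt Hnet]]] := fnet e60.
  have osc : \forall n \near U, forall s, `|u_ n s - u_ n (pt (cell s))| <= e / 3.
    have := near_ultra_inv e60; apply: filterS => n n_e s.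
    have [unB fu] := Hu n; have := Hnet _ unB s.
    have {}fu s' := le_trans (fu s') n_e.
    have := fu s; have := fu (pt (cell s)).
    by rewrite !ler_distl => /andP[? ?] /andP[? ?] /andP[? ?]; lra.
  have osc_lim s : `|u s - u (pt (cell s))| <= e / 3.
    apply: ulim_norm_le (cvgB (uc s) (uc (pt (cell s)))) _.
    by apply: filterS osc.
  have pts : \forall n \near U, forall k, `|u_ n (pt k) - u (pt k)| <= e / 3.
    apply: filter_forall => k; apply: cvgr_distC_le (uc _) _ _.
    by rewrite divr_gt0.
  near=> n => s; have := osc_lim s.
  have : `|u_ n s - u_ n (pt (cell s))| <= e / 3.
    by move: s; near: n.
  have : `|u_ n (pt (cell s)) - u (pt (cell s))| <= e / 3.
    by move: (cell s); near: n.
  rewrite !ler_distl.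
  by move=> /andP[? ?] /andP[? ?] /andP[? ?]; lra.
exists u => // s.
have fuc : f (u_ n) s @[n --> U] --> f u s.
  by apply: fC => // n; apply: (Hu n).1.
rewrite -(cvg_ulim fuc); apply: cvg_ulim.
apply: (@cvg_ultra_small _ _ _ _ 1 (uc s)) => n.
by rewrite div1r; apply: (Hu n).2.
Unshelve. all: by end_near.
Qed.

End Schauder.

(** * An integral for all bounded functions *)

Section Primitive.
Variables (R : realType) (T : R).
Hypothesis T0 : 0 < T.
Implicit Types (f g : R -> R) (s t u : R) (n : nat).

(** A grid of mesh T / (n + 1). It is indexed by nat and starts n + 1 periods
    before 0, so that it eventually reaches every real number; its mesh
    divides T, so that the sums of a T-periodic function are invariant under
    the period. *)
Definition node n (i : nat) : R := T * (i%:R / n.+1%:R - n.+1%:R).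

(** Index of the first grid point that is not less than t, if t is in the
    range of the grid. *)
Definition nodes_below n t : nat := `|Num.ceil (n.+1%:R * (t / T + n.+1%:R))|%N.

Definition riemann n f t : R :=
  T / n.+1%:R * \sum_(0 <= i < nodes_below n t) f (node n i).

(** The oriented integral of f from 0 to t. *)
Definition prim f t : R := ulim (fun n => riemann n f t - riemann n f 0).

Definition in_range n t := - (T * n.+1%:R) <= t.

Lemma in_range_near t : \forall n \near U, in_range n t.
Proof.
apply: nat_ultra_eventually; near=> n; rewrite /in_range lerNl.
have -> : - t = T * (- t / T) by rewrite mulrC divfK ?gt_eqF.
rewrite ler_pM2l //; apply: le_trans (_ : n%:R <= _); last by rewrite ler_nat.
by near: n; apply: nbhs_infty_ger.
Unshelve. all: by end_near.
Qed.

Lemma in_range_le n s t : in_range n s -> s <= t -> in_range n t.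
Proof. exact: le_trans. Qed.

Let n0 n : 0 < n.+1%:R :> R. Proof. by []. Qed.

Lemma scaled_ge0 n t : in_range n t -> 0 <= n.+1%:R * (t / T + n.+1%:R).
Proof.
rewrite /in_range => nt; rewrite mulr_ge0 // -lerBlDr sub0r ler_pdivlMr //.
by rewrite mulNr mulrC.
Qed.

Lemma nodes_belowE n t : in_range n t ->
  (nodes_below n t)%:R = (Num.ceil (n.+1%:R * (t / T + n.+1%:R)))%:~R :> R.
Proof.
move=> /scaled_ge0 y0; rewrite /nodes_below natr_absz ger0_norm //.
by rewrite ceil_ge0 (lt_le_trans _ y0).
Qed.

Lemma lt_nodes_below n t i : in_range n t ->
  (i < nodes_below n t)%N = (node n i < t).
Proof.
move=> nt; rewrite -(ltr_nat R) nodes_belowE // -[i%:R]/(i%:~R) ltr_int ceil_gt_int.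
rewrite mulrDr -ltrBlDr -[LHS](@ltr_pM2l _ (T / n.+1%:R)) ?divr_gt0 //.
congr (_ < _); rewrite /node; field; rewrite ?gt_eqF //.
Qed.

Lemma nodes_below_bounds n t : in_range n t ->
  t <= node n (nodes_below n t) < t + T / n.+1%:R.
Proof.
move=> nt; apply/andP; split; first by rewrite leNgt -lt_nodes_below // ltnn.
rewrite /node nodes_belowE //.
rewrite -(@ltr_pM2l _ (n.+1%:R / T)) ?divr_gt0 //.
rewrite [ltLHS](_ : _ = (Num.ceil (n.+1%:R * (t / T + n.+1%:R)))%:~R
                         - n.+1%:R * n.+1%:R); last first.
  by field; rewrite ?gt_eqF.
have := ceilB1_lt (n.+1%:R * (t / T + n.+1%:R)).
rewrite intrD /= mulrDr ltrBlDr => H.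
rewrite [ltRHS](_ : _ = n.+1%:R * (t / T) + 1); last first.
  by field; rewrite ?gt_eqF.
by rewrite ltrBlDr -addrA [1 + _]addrC addrA.
Qed.

Lemma nodes_below_le n s t : s <= t -> in_range n s ->
  (nodes_below n s <= nodes_below n t)%N.
Proof.
move=> st ns; rewrite leqNgt lt_nodes_below // -leNgt.
have nt := in_range_le ns st.
by apply: le_trans st _; case/andP: (nodes_below_bounds nt).
Qed.

Lemma riemann_incr n f s t : s <= t -> in_range n s ->
  riemann n f t - riemann n f s =
  T / n.+1%:R * \sum_(nodes_below n s <= i < nodes_below n t) f (node n i).
Proof.
move=> st ns; rewrite /riemann -mulrBr; congr (_ * _).
by rewrite (big_cat_nat (leq0n _) (nodes_below_le st ns)) /= addrAC subrr add0r.
Qed.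

Lemma riemann_mono n f g s t : s <= t -> in_range n s ->
  (forall u, s <= u < t -> f u <= g u) ->
  riemann n f t - riemann n f s <= riemann n g t - riemann n g s.
Proof.
move=> st ns fg; rewrite !riemann_incr // ler_pM2l ?divr_gt0 //.
rewrite !big_nat; apply: ler_sum => i /andP[si it]; apply: fg.
rewrite -lt_nodes_below ?(in_range_le ns st) // it andbT.
by rewrite leNgt -lt_nodes_below // -leqNgt.
Qed.

Lemma riemann_lin n f g k t :
  riemann n (fun u => f u + k * g u) t = riemann n f t + k * riemann n g t.
Proof.
by rewrite /riemann big_split /= -mulr_sumr mulrDr [k * (_ * _)]mulrCA.
Qed.

Lemma riemann_cst n k s t : s <= t -> in_range n s ->
  `|riemann n (fun=> k) t - riemann n (fun=> k) s - k * (t - s)|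
    <= `|k| * T / n.+1%:R.
Proof.
move=> st ns; have nt := in_range_le ns st.
rewrite riemann_incr // big_const_nat iter_addr_0 -[k *+ _]mulr_natr.
rewrite natrB ?nodes_below_le //.
set a : R := (nodes_below n t)%:R - (nodes_below n s)%:R.
have -> : T / n.+1%:R * (k * a) - k * (t - s) = k * (T / n.+1%:R * a - (t - s)).
  by ring.
rewrite normrM -[leRHS]mulrA ler_wpM2l //.
have -> : T / n.+1%:R * a = node n (nodes_below n t) - node n (nodes_below n s).
  by rewrite /node /a; field.
have /andP[] := nodes_below_bounds ns; have /andP[] := nodes_below_bounds nt.
by rewrite ler_norml; move: (T / n.+1%:R) => d; lra.
Qed.

Lemma riemann_bound n f M s t : (forall u, `|f u| <= M) -> s <= t ->
  in_range n s -> `|riemann n f t - riemann n f s| <= M * (t - s) + M * T.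
Proof.
move=> fM st ns.
have M0 : 0 <= M by apply: le_trans (fM 0).
have hi := @riemann_mono n f (fun=> M) s t st ns.
have lo := @riemann_mono n (fun=> - M) f s t st ns.
have := riemann_cst M st ns; have := riemann_cst (- M) st ns.
have : M * T / n.+1%:R <= M * T.
  by rewrite ler_pdivrMr // ler_peMr ?mulr_ge0 ?(ltW T0) // ler1n.
rewrite normrN (ger0_norm M0) !ler_distl; move: (M * T / n.+1%:R) => d.
move=> le1 /andP[lo1 lo2] /andP[hi1 hi2].
have {}hi : riemann n f t - riemann n f s <=
  riemann n (fun=> M) t - riemann n (fun=> M) s.
  by apply: hi => u _; have := fM u; rewrite ler_norml => /andP[].
have {}lo : riemann n (fun=> - M) t - riemann n (fun=> - M) s <=
  riemann n f t - riemann n f s.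
  by apply: lo => u _; have := fM u; rewrite ler_norml => /andP[].
by move: lo1; rewrite mulNr; lra.
Qed.

Definition bounded_fct f := exists M, forall u, `|f u| <= M.

Lemma prim_cvg f t : bounded_fct f ->
  riemann n f t - riemann n f 0 @[n --> U] --> prim f t.
Proof.
move=> [M fM]; apply: (@ulim_cvg _ _ (M * `|t| + M * T)); near=> n.
have n_0 : in_range n 0 by near: n; apply: in_range_near.
have n_t : in_range n t by near: n; apply: in_range_near.
have [t0|/ltW t0] := leP 0 t.
  by have := riemann_bound fM t0 n_0; rewrite subr0 (ger0_norm t0).
by have := riemann_bound fM t0 n_t; rewrite sub0r (ler0_norm t0) distrC.
Unshelve. all: by end_near.
Qed.

Lemma prim0 f : prim f 0 = 0.
Proof.
by apply: cvg_ulim; under eq_fun do rewrite subrr; apply: cvg_cst.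
Qed.

Lemma prim_incr_cvg f s t : bounded_fct f ->
  riemann n f t - riemann n f s @[n --> U] --> prim f t - prim f s.
Proof.
move=> fb; have -> : (fun n => riemann n f t - riemann n f s) = (fun n =>
    (riemann n f t - riemann n f 0) - (riemann n f s - riemann n f 0)).
  by apply/funext => n; ring.
by apply: cvgB; apply: prim_cvg.
Qed.

Lemma prim_mono f g s t : bounded_fct f -> bounded_fct g -> s <= t ->
  (forall u, s <= u < t -> f u <= g u) ->
  prim f t - prim f s <= prim g t - prim g s.
Proof.
move=> fb gb st fg.
apply: ulim_le (@prim_incr_cvg f s t fb) (@prim_incr_cvg g s t gb) _.
by apply: filterS (in_range_near s) => n ns; apply: riemann_mono.
Qed.

Lemma bounded_lin f g k : bounded_fct f -> bounded_fct g ->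
  bounded_fct (fun u => f u + k * g u).
Proof.
move=> [M fM] [N gN]; exists (M + `|k| * N) => u.
by rewrite (le_trans (ler_normD _ _)) // lerD // normrM ler_wpM2l.
Qed.

Lemma prim_lin f g k t : bounded_fct f -> bounded_fct g ->
  prim (fun u => f u + k * g u) t = prim f t + k * prim g t.
Proof.
move=> fb gb; apply: cvg_ulim.
have -> : (fun n => riemann n (fun u => f u + k * g u) t -
      riemann n (fun u => f u + k * g u) 0) =
    (fun n => (riemann n f t - riemann n f 0) +
      k * (riemann n g t - riemann n g 0)).
  by apply/funext => n; rewrite !riemann_lin; ring.
by apply: cvgD; [|apply: cvgMr]; apply: prim_cvg.
Qed.

Lemma prim_cst k t : prim (fun=> k) t = k * t.
Proof.
apply: cvg_ulim; apply/cvgrPdist_le => e e0.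
have k0 : 0 < `|k| * T + 1 by rewrite ltr_wpDl // mulr_ge0 // ltW.
have e1 : 0 < e / (`|k| * T + 1) by rewrite divr_gt0.
near=> n.
have H : `|k| * T / n.+1%:R <= e.
  have : n.+1%:R^-1 <= e / (`|k| * T + 1) by near: n; apply: near_ultra_inv.
  rewrite ler_pdivlMr // mulrC mulrDl mul1r; apply: le_trans.
  by rewrite lerDl invr_ge0.
apply: le_trans H; have [t0|/ltW t0] := leP 0 t.
  rewrite distrC -[X in k * X]subr0 riemann_cst //.
  by near: n; apply: in_range_near.
have : `|riemann n (fun=> k) 0 - riemann n (fun=> k) t - k * (0 - t)|
    <= `|k| * T / n.+1%:R.
  by apply: riemann_cst => //; near: n; apply: in_range_near.
by rewrite !ler_norml; move: (`|k| * T / n.+1%:R) => d; lra.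
Unshelve. all: by end_near.
Qed.

Lemma nodes_below_shift n t : in_range n t ->
  nodes_below n (t + T) = (n.+1 + nodes_below n t)%N.
Proof.
move=> nt; apply/eqP; rewrite -(eqr_nat R) natrD !nodes_belowE //; last first.
  by apply: in_range_le nt _; rewrite lerDl ltW.
have -> : n.+1%:R * ((t + T) / T + n.+1%:R) =
  n.+1%:R * (t / T + n.+1%:R) + n.+1%:R by field; rewrite gt_eqF.
have ceil_n : Num.ceil (n.+1%:R : R) = n.+1 by exact: (@intrKceil R n.+1).
by rewrite ceilDrz ?natr_int // intrD ceil_n addrC.
Qed.

Lemma riemann_shift n f t : (forall u, f (u + T) = f u) -> in_range n t ->
  riemann n f (t + T) =
  riemann n f t + T / n.+1%:R * \sum_(0 <= i < n.+1) f (node n i).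
Proof.
move=> fT nt; rewrite /riemann nodes_below_shift // -mulrDr; congr (_ * _).
rewrite (big_cat_nat (leq0n n.+1) (leq_addr (nodes_below n t) _)) /= addrC; congr (_ + _).
rewrite -{1}[n.+1]add0n big_addn addKn; apply: eq_bigr => i _.
rewrite -[RHS]fT; congr f; rewrite /node natrD; field.
by rewrite addrC natr1.
Qed.

Lemma prim_shift f t : bounded_fct f -> (forall u, f (u + T) = f u) ->
  prim f (t + T) = prim f t + prim f T.
Proof.
move=> fb fT; apply: cvg_ulim.
apply: cvg_ultra_eq (cvgD (@prim_cvg f t fb) (@prim_cvg f T fb)).
near=> n.
have n_0 : in_range n 0 by near: n; apply: in_range_near.
have n_t : in_range n t by near: n; apply: in_range_near.
rewrite (riemann_shift fT n_t) -{2}[T]add0r (riemann_shift fT n_0); ring.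
Unshelve. all: by end_near.
Qed.

End Primitive.

Section PrimitiveEstimates.
Variables (R : realType) (T : R).
Hypothesis T0 : 0 < T.
Implicit Types (f g : R -> R) (k s t u y z e : R).

Lemma bounded_fct_cst k : bounded_fct (fun _ : R => k).
Proof. by exists `|k|. Qed.

Lemma prim_dist f g s t e : bounded_fct f -> bounded_fct g -> s <= t ->
  (forall u, s <= u < t -> `|f u - g u| <= e) ->
  `|(prim T f t - prim T f s) - (prim T g t - prim T g s)| <= e * (t - s).
Proof.
move=> fb gb st fg.
have cb := bounded_fct_cst 1; have gb' k := bounded_lin k gb cb.
have Hhi : forall u, s <= u < t -> f u <= g u + e * 1.
  by move=> u /fg; rewrite ler_distl => /andP[]; lra.
have Hlo : forall u, s <= u < t -> g u + - e * 1 <= f u.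
  by move=> u /fg; rewrite ler_distl => /andP[]; lra.
have := prim_mono T0 fb (gb' e) st Hhi.
have := prim_mono T0 (gb' (- e)) fb st Hlo.
by rewrite !prim_lin // !prim_cst // ler_norml; lra.
Qed.

Lemma prim_near_cst f k s t e : bounded_fct f -> s <= t ->
  (forall u, s <= u < t -> `|f u - k| <= e) ->
  `|prim T f t - prim T f s - k * (t - s)| <= e * (t - s).
Proof.
move=> fb st fk; have := prim_dist fb (bounded_fct_cst k) st fk.
by rewrite !prim_cst // -mulrBr.
Qed.

Lemma prim_lipschitz f M s t : (forall u, `|f u| <= M) ->
  `|prim T f t - prim T f s| <= M * `|t - s|.
Proof.
move=> fM; wlog st : s t / s <= t.
  move=> H; have [/H//|/ltW/H] := leP s t.
  by rewrite distrC (distrC s).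
have fb : bounded_fct f by exists M.
rewrite (ger0_norm (_ : 0 <= t - s)) ?subr_ge0 //.
have := @prim_near_cst f 0 s t M fb st; rewrite mul0r subr0; apply.
by move=> u _; rewrite subr0.
Qed.

Lemma primZ k f t : bounded_fct f -> prim T (fun u => k * f u) t = k * prim T f t.
Proof.
move=> fb; have := prim_lin T0 k t (bounded_fct_cst 0) fb.
rewrite prim_cst // mul0r add0r => <-; congr (prim T _ t).
by apply/funext => u; rewrite add0r.
Qed.

Lemma boundedZ k f : bounded_fct f -> bounded_fct (fun u => k * f u).
Proof.
by move=> [M fM]; exists (`|k| * M) => u; rewrite normrM ler_wpM2l.
Qed.

Lemma primB f g t : bounded_fct f -> bounded_fct g ->
  prim T (fun u => f u - g u) t = prim T f t - prim T g t.
Proof.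
move=> fb gb; have := prim_lin T0 (-1) t fb gb; rewrite mulN1r => <-.
by congr (prim T _ t); apply/funext => u; rewrite mulN1r.
Qed.

Lemma boundedB f g : bounded_fct f -> bounded_fct g ->
  bounded_fct (fun u => f u - g u).
Proof.
move=> fb gb; have [M fM] := bounded_lin (-1) fb gb; exists M => u.
by rewrite -mulN1r.
Qed.

Lemma boundedM f g : bounded_fct f -> bounded_fct g ->
  bounded_fct (fun u => f u * g u).
Proof.
by move=> [M fM] [N gN]; exists (M * N) => u; rewrite normrM ler_pM.
Qed.

(** The integrand lies below f y to the right of y and above it to the left. *)
Lemma concave_prim f y z : bounded_fct f -> {homo f : s t /~ s <= t} ->
  prim T f z - prim T f y <= f y * (z - y).
Proof.
move=> fb fd; have cb := bounded_fct_cst (f y).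
have [yz|/ltW zy] := leP y z.
  have H u : y <= u < z -> f u <= f y by move=> /andP[yu _]; apply: fd.
  by have := prim_mono T0 fb cb yz H; rewrite !prim_cst // mulrBr.
have H u : z <= u < y -> f y <= f u by move=> /andP[_ /ltW uy]; apply: fd.
have := prim_mono T0 cb fb zy H; rewrite !prim_cst // mulrBr.
by rewrite -[_ <= prim T f y - _]lerN2 !opprB.
Qed.

End PrimitiveEstimates.

(** * Calculus on a periodic time scale *)

Lemma within_continuousP (R : realType) (A : set R) (f : R -> R) :
  {within A, continuous f} <->
  (forall t, A t -> forall e, 0 < e -> exists2 d, 0 < d &
     forall s, A s -> `|s - t| < d -> `|f s - f t| <= e).
Proof.
split.
  move=> /subspace_continuousP fc t At e e0.
  have /cvgrPdistC_le/(_ e e0) := fc t At.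
  rewrite near_withinE => /nbhs_ballP[d /= d0 dH]; exists d => // s As st.
  by apply: dH => //=; rewrite /ball /= distrC.
move=> H; apply/subspace_continuousP => t At; apply/cvgrPdistC_le => e e0.
have [d d0 dH] := H t At e e0.
rewrite near_withinE; apply/nbhs_ballP; exists d => //= s st As.
by apply: dH => //; rewrite distrC.
Qed.

Lemma within_continuous_ext (R : realType) (A : set R) (f g : R -> R) :
  (forall t, A t -> f t = g t) ->
  {within A, continuous f} -> {within A, continuous g}.
Proof.
move=> fg /within_continuousP fc; apply/within_continuousP => t At e e0.
have [d d0 dP] := fc t At e e0; exists d => // s As st.
by rewrite -!fg // dP.
Qed.

Lemma closed_approx (R : realType) (A : set R) (x : R) : closed A ->
  (forall e, 0 < e -> exists2 a, A a & `|a - x| < e) -> A x.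
Proof.
move=> Ac H; apply: Ac => B /nbhs_ballP[e /= e0 eB].
have [a Aa ax] := H e e0; exists a; split => //; apply: eB.
by rewrite /ball /= distrC.
Qed.

Section TimeScale.
Variables (R : realType) (T : R) (TS : set R).
Hypothesis T0 : 0 < T.
Hypothesis TSc : closed TS.
Hypothesis TSper : periodic_time_scale T TS.
Hypothesis TS0 : TS 0.
Implicit Types (f g : R -> R) (s t u e : R).

Lemma ts_addT t : TS t -> TS (t + T).
Proof. by move=> tTS; rewrite -TSper; exists t. Qed.

Lemma ts_subT t : TS t -> TS (t - T).
Proof. by rewrite -{1}TSper => -[s sTS <-]; rewrite addrK. Qed.

Lemma ts_shift t (z : int) : TS t -> TS (t + z%:~R * T).
Proof.
move=> tTS; elim/int_rec: z => [|n IH|n IH].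
- by rewrite mul0r addr0.
- by rewrite intS intrD mulrDl mul1r addrCA addrC; apply: ts_addT.
- rewrite -addn1 PoszD opprD intrD mulrDl mulN1r addrA.
  exact: ts_subT.
Qed.

Lemma periodic_on_shift f t (z : int) : periodic_on T TS f -> TS t ->
  f (t + z%:~R * T) = f t.
Proof.
move=> fT tTS; elim/int_rec: z => [|n IH|n IH].
- by rewrite mul0r addr0.
- rewrite intS intrD mulrDl mul1r addrCA addrC fT //; exact: ts_shift.
- rewrite -addn1 PoszD opprD intrD mulrDl mulN1r addrA.
  by rewrite -[LHS]fT ?subrK //; apply/ts_subT/ts_shift.
Qed.

Lemma ts_unbounded_below s : exists2 t, TS t & t <= s.
Proof.
exists (0 + (Num.floor (s / T))%:~R * T); first exact: ts_shift.
by rewrite add0r -ler_pdivlMr // floor_le.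
Qed.

Lemma ts_unbounded_above s : exists2 t, TS t & s < t.
Proof.
exists (0 + (Num.floor (s / T) + 1)%:~R * T); first exact: ts_shift.
by rewrite add0r -ltr_pdivrMr // floorD1_gt.
Qed.

(** Composition with this map turns a function on the time scale into a
    function on the real line that is constant on each gap, with the value at
    its left end, which is how a delta integral weighs a gap. *)
Definition floor_ts s := sup [set t | TS t /\ t <= s].

Lemma has_sup_below s : has_sup [set t | TS t /\ t <= s].
Proof.
split; first by have [t] := ts_unbounded_below s; exists t.
by exists s => t [].
Qed.

Lemma floor_ts_le s : floor_ts s <= s.
Proof. by apply: ge_sup; [case: (has_sup_below s)|move=> t []]. Qed.

Lemma floor_ts_ge s t : TS t -> t <= s -> t <= floor_ts s.
Proof. by move=> tTS ts; apply: (sup_upper_bound (has_sup_below s)). Qed.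

Lemma floor_ts_in s : TS (floor_ts s).
Proof.
apply: closed_approx TSc _ => e e0.
have [t [tTS ts]] := sup_adherent e0 (has_sup_below s).
rewrite -/(floor_ts s) => st; exists t => //.
by have := floor_ts_ge tTS ts; rewrite ltr_norml; lra.
Qed.

Lemma floor_ts_id t : TS t -> floor_ts t = t.
Proof. by move=> tTS; apply/le_anti; rewrite floor_ts_le floor_ts_ge. Qed.

Lemma floor_tsK s : floor_ts (floor_ts s) = floor_ts s.
Proof. exact/floor_ts_id/floor_ts_in. Qed.

Lemma floor_ts_shift s : floor_ts (s + T) = floor_ts s + T.
Proof.
apply/le_anti; rewrite [X in _ && X]floor_ts_ge ?andbT; last 2 first.
- exact/ts_addT/floor_ts_in.
- by rewrite lerD2r floor_ts_le.
rewrite -lerBlDr floor_ts_ge //; first exact/ts_subT/floor_ts_in.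
by rewrite lerBlDr floor_ts_le.
Qed.

Local Notation sigma := (forward_jump TS).

Lemma has_inf_above t : has_inf [set s | TS s /\ t < s].
Proof.
split; first by have [s] := ts_unbounded_above t; exists s.
by exists t => s [_ /ltW].
Qed.

Lemma sigma_ge t : t <= sigma t.
Proof.
apply: lb_le_inf; first by case: (has_inf_above t).
by move=> s [_ /ltW].
Qed.

Lemma sigma_le s t : TS s -> t < s -> sigma t <= s.
Proof. by move=> sTS ts; apply: ge_inf; [case: (has_inf_above t)|]. Qed.

Lemma sigma_adherent t e : 0 < e ->
  exists s, [/\ TS s, t < s & s < sigma t + e].
Proof.
by move=> e0; have [s [sTS ts] st] := inf_adherent e0 (has_inf_above t);
  exists s.
Qed.

Lemma sigma_in t : TS (sigma t).
Proof.
apply: closed_approx TSc _ => e e0.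
have [s [sTS ts se]] := sigma_adherent t e0; exists s => //.
by have := sigma_le sTS ts; rewrite ltr_norml; lra.
Qed.

(** Between a point s near t and the forward jump of t, the integrand only
    takes values of f at points of the time scale between s and t, up to the
    gap after t where it is equal to f t. If t has a gap on its right, d is
    chosen so small that s cannot be beyond it. *)
Lemma is_delta_deriv_prim f t : bounded_fct f ->
  (forall u, f u = f (floor_ts u)) -> {within TS, continuous f} -> TS t ->
  is_delta_deriv TS (prim T f) t (f t).
Proof.
move=> fb ffl /within_continuousP fc tTS e e0.
have [d0 d0_gt0 d0P] := fc t tTS e e0.
pose d := if sigma t == t then d0 else Num.min d0 (sigma t - t).
have dd0 : d <= d0 by rewrite /d; case: ifP => // _; rewrite ge_min lexx.
have st := sigma_ge t.
exists d => [|s sTS sd].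
  rewrite /d; case: ifPn => // tN; rewrite lt_min d0_gt0 subr_gt0 lt_neqAle.
  by rewrite eq_sym tN.
have fl_near u : t <= floor_ts u <= s \/ s <= floor_ts u <= t ->
    `|f u - f t| <= e.
  move=> fu; rewrite ffl; apply: d0P; first exact: floor_ts_in.
  by move: sd; rewrite !ltr_norml; case: fu; lra.
have [ss|ss] := leP s (sigma t).
  rewrite (ger0_norm (_ : 0 <= sigma t - s)) ?subr_ge0 //.
  apply: prim_near_cst => // u /andP[su ut]; apply: fl_near.
  have flu := floor_ts_le u.
  have [tu|tu] := leP t u; last by right; rewrite floor_ts_ge //; lra.
  have [ft|ft] := leP (floor_ts u) t.
    have -> : floor_ts u = t by apply/le_anti; rewrite ft floor_ts_ge.
    by have [st'|st'] := leP s t; [right|left]; lra.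
  by have := sigma_le (floor_ts_in u) ft; lra.
have tt : sigma t = t.
  apply/eqP/negPn/negP => tN; move: sd; rewrite /d (negbTE tN) lt_min.
  by rewrite !ltr_norml; lra.
rewrite tt in ss st *.
rewrite -normrN (ltr0_norm (_ : t - s < 0)) ?subr_lt0 //.
rewrite [X in `|X|](_ : _ = prim T f s - prim T f t - f t * (s - t)); last by ring.
rewrite opprB; apply: prim_near_cst => //; first exact: ltW.
move=> u /andP[tu us]; apply: fl_near; left.
by rewrite floor_ts_ge // (le_trans (floor_ts_le u)) // ltW.
Qed.

(** Arbitrarily close to t there are points s different from the forward
    jump: t itself if it is followed by a gap, points to the right of t
    otherwise. *)
Lemma is_delta_deriv_unique f t l1 l2 : TS t ->
  is_delta_deriv TS f t l1 -> is_delta_deriv TS f t l2 -> l1 = l2.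
Proof.
move=> tTS f1 f2; apply/eqP; rewrite -subr_eq0 -normr_le0.
apply/ler_addgt0Pr => e e0; rewrite add0r.
have e20 : 0 < e / 2 by rewrite divr_gt0.
have [d1 d10 d1P] := f1 _ e20; have [d2 d20 d2P] := f2 _ e20.
have [s [sTS sd1 sd2 sN]] : exists s,
    [/\ TS s, `|s - t| < d1, `|s - t| < d2 & sigma t - s != 0].
  have [st|st] := eqVneq (sigma t) t; last first.
    by exists t; rewrite subrr normr0 subr_eq0.
  have d0 : 0 < Num.min d1 d2 by rewrite lt_min d10.
  have [s [sTS ts]] := sigma_adherent t d0.
  rewrite st -ltrBlDl lt_min => /andP[sd1 sd2]; exists s; split => //.
  - by rewrite gtr0_norm ?subr_gt0.
  - by rewrite gtr0_norm ?subr_gt0.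
  - by rewrite subr_eq0 lt_eqF.
have {sN}s0 : 0 < `|sigma t - s| by rewrite normr_gt0.
rewrite -(ler_pM2r s0) -normrM.
have := d1P s sTS sd1; have := d2P s sTS sd2.
rewrite mulrBl; move: (l1 * _) (l2 * _) (f _ - f s) => a b c.
by rewrite !ler_norml; move: `|sigma t - s| => k; lra.
Qed.

Lemma delta_derivE f t l : TS t -> is_delta_deriv TS f t l ->
  delta_deriv TS f t = l.
Proof.
by move=> tTS fl; apply: xget_unique => // l' /(is_delta_deriv_unique tTS);
  apply.
Qed.

Lemma is_delta_deriv_ext f g t l : (forall s, TS s -> f s = g s) ->
  is_delta_deriv TS f t l -> is_delta_deriv TS g t l.
Proof.
move=> fg fl e /fl[d d0 dP]; exists d => // s sTS sd.
by rewrite -!fg //; [apply: dP|apply: sigma_in].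
Qed.

Lemma is_delta_derivB f g t l k : is_delta_deriv TS f t l ->
  is_delta_deriv TS g t k -> is_delta_deriv TS (fun s => f s - g s) t (l - k).
Proof.
move=> fl gk e e0; have e20 : 0 < e / 2 by rewrite divr_gt0.
have [d1 d10 d1P] := fl _ e20; have [d2 d20 d2P] := gk _ e20.
exists (Num.min d1 d2) => [|s sTS]; first by rewrite lt_min d10.
rewrite lt_min => /andP[/(d1P _ sTS) + /(d2P _ sTS)].
rewrite mulrBl; move: (l * _) (k * _) => a b; move: `|sigma t - s| => c.
by rewrite !ler_norml; lra.
Qed.

(** The points of the time scale in [a, b] at which D lies above the line of
    slope -e through (a, D a) have a largest element c. If c < b, then they
    also contain the forward jump of c when c is followed by a gap, and
    points just after c otherwise. *)
Lemma ts_nondecreasing (D : R -> R) a b : TS a -> TS b -> a <= b ->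
  {within TS, continuous D} ->
  (forall t, TS t -> a <= t < b -> t < sigma t -> D t <= D (sigma t)) ->
  (forall t, TS t -> a <= t < b -> sigma t = t -> forall e, 0 < e ->
     exists2 d, 0 < d & forall s, TS s -> t < s < t + d ->
       D t - e * (s - t) <= D s) ->
  D a <= D b.
Proof.
move=> aTS bTS ab /within_continuousP Dc scattered dense.
apply/ler_addgt0Pr => e' e'0.
pose e := e' / (b - a + 1).
have ba : 0 <= b - a by rewrite subr_ge0.
have e0 : 0 < e by rewrite divr_gt0 // ltr_wpDl.
suff : D a - e * (b - a) <= D b.
  have : e * (b - a) <= e'.
    by rewrite /e mulrAC ler_pdivrMr ?ltr_wpDl // ler_pM2l // lerDl.
  by lra.
pose S := [set s | [/\ TS s, a <= s <= b & D a - e * (s - a) <= D s]].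
have Sa : S a by split; rewrite ?lexx //; lra.
have Ssup : has_sup S by split; [exists a|exists b => s [_ /andP[]]].
pose c := sup S.
have cub s : S s -> s <= c by exact: sup_upper_bound.
have cadh d : 0 < d -> exists2 s, S s & c - d < s by move=> d0; apply: sup_adherent.
have cTS : TS c.
  apply: closed_approx TSc _ => d d0; have [s Ss cs] := cadh d d0.
  by exists s; [case: Ss|have := cub s Ss; rewrite ltr_norml; lra].
have ac : a <= c by exact: cub.
have cb : c <= b by apply: ge_sup; [exists a|move=> s [_ /andP[]]].
have Sc : S c.
  split; rewrite ?ac ?cb //; apply/ler_addgt0Pr => k k0.
  have [d d0 dP] := Dc c cTS k k0; have [s Ss cs] := cadh d d0.
  have sc := cub s Ss; case: Ss => sTS _ Ds.
  have /(dP s sTS) : `|s - c| < d by rewrite ltr_norml; lra.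
  have : e * (s - a) <= e * (c - a) by rewrite ler_pM2l //; lra.
  by rewrite ler_norml; lra.
have [cb'|bc] := ltP c b; last first.
  by have <- : c = b by [lra]; case: Sc.
exfalso; case: Sc => _ _ Dc_ge.
have [sc|sc] := eqVneq (sigma c) c; last first.
  have csc : c < sigma c by rewrite lt_neqAle eq_sym sc sigma_ge.
  have : S (sigma c).
    split; [exact: sigma_in| |].
      by rewrite (le_trans ac (ltW csc)) sigma_le.
    apply: le_trans (scattered c cTS _ csc); last by rewrite ac.
    have : e * (c - a) <= e * (sigma c - a) by rewrite ler_pM2l //; lra.
    by lra.
  by move=> /cub; lra.
have cab : a <= c < b by rewrite ac.
have [d d0 dP] := dense c cTS cab sc e e0.
have [|s [sTS cs sd]] := @sigma_adherent c (Num.min d (b - c)).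
  by rewrite lt_min d0 subr_gt0.
move: sd; rewrite sc -ltrBlDl lt_min => /andP[sd sb].
have : S s.
  split => //; first by lra.
  by have := dP s sTS; rewrite cs -ltrBlDl sd => /(_ isT); lra.
by move=> /cub; lra.
Qed.

Lemma delta_deriv_continuous f : (forall t, TS t -> delta_derivable TS f t) ->
  {within TS, continuous f}.
Proof.
move=> fd; apply/within_continuousP => t tTS e e0.
(* compare the two increments of f from s and from t up to the forward jump *)
have [l fl] := fd t tTS.
pose m := `|sigma t - t|; have m0 : 0 <= m by exact: normr_ge0.
pose e1 := e / (2 * (2 * m + 1)).
have m1 : 0 < 2 * m + 1 by lra.
have e10 : 0 < e1 by rewrite divr_gt0 // mulr_gt0.
have [d1 d10 d1P] := fl e1 e10.
have l0 : 0 < 2 * (`|l| + 1) by rewrite mulr_gt0 // ltr_wpDl.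
exists (Num.min d1 (Num.min 1 (e / (2 * (`|l| + 1))))) => [|s sTS].
  by rewrite !lt_min d10 ltr01 divr_gt0.
rewrite !lt_min => /and3P[sd1 s1 sl].
have := d1P s sTS sd1; have := d1P t tTS; rewrite subrr normr0 => /(_ d10).
have : `|sigma t - s| <= m + 1.
  rewrite -(subrK t (sigma t)) -addrA (le_trans (ler_normD _ _)) // lerD //.
  by rewrite distrC ltW.
rewrite -/m => H Ht Hs.
have {}Hs := le_trans Hs (ler_wpM2l (ltW e10) H).
have : `|l * (s - t)| <= e / 2.
  rewrite normrM; apply: le_trans (_ : (`|l| + 1) * `|s - t| <= _).
    by rewrite ler_wpM2r // lerDl.
  by move: sl; rewrite invfM mulrA ltr_pdivlMr ?ltr_wpDl // mulrC => /ltW.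
have e1E : e1 * m + e1 * (m + 1) = e / 2.
  by rewrite /e1; field; rewrite gt_eqF.
by move: Ht Hs; rewrite !ler_norml !mulrBr; lra.
Qed.

Lemma delta_deriv0_constant f a b : TS a -> TS b -> a <= b ->
  (forall t, TS t -> is_delta_deriv TS f t 0) -> f a = f b.
Proof.
move=> aTS bTS ab f0.
have fc : {within TS, continuous f}.
  by apply: delta_deriv_continuous => t tTS; exists 0; apply: f0.
have sc t : TS t -> f (sigma t) = f t.
  move=> tTS; apply/eqP; rewrite -subr_eq0 -normr_le0.
  apply/ler_addgt0Pr => e e0; rewrite add0r.
  pose k := `|sigma t - t| + 1.
  have k0 : 0 < k by rewrite ltr_wpDl.
  have [d d0 dP] := f0 t tTS (e / k) (divr_gt0 e0 k0).
  have := dP t tTS; rewrite subrr normr0 => /(_ d0).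
  rewrite mul0r subr0 => /le_trans; apply.
  by rewrite mulrAC ler_pdivrMr // ler_pM2l // lerDl.
have dn t : TS t -> sigma t = t -> forall e, 0 < e -> exists2 d, 0 < d &
    forall s, TS s -> t < s < t + d -> `|f t - f s| <= e * (s - t).
  move=> tTS st e /(f0 t tTS)[d d0 dP]; exists d => // s sTS /andP[ts sd].
  have := dP s sTS; rewrite st mul0r subr0 (distrC t) gtr0_norm ?subr_gt0 //.
  by apply; lra.
apply/le_anti/andP; split.
  apply: ts_nondecreasing => // [t tTS _ _|t tTS _ st e e0].
    by rewrite sc.
  have [d d0 dP] := dn t tTS st e e0; exists d => // s sTS /(dP s sTS).
  by rewrite ler_norml; lra.
rewrite -lerN2; apply: (@ts_nondecreasing (fun t => - f t)) => //.
- move=> t; apply: continuousN; exact: fc.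
- by move=> t tTS _ _; rewrite sc.
move=> t tTS _ st e e0.
have [d d0 dP] := dn t tTS st e e0; exists d => // s sTS /(dP s sTS).
by rewrite ler_norml; lra.
Qed.

(** All values are taken on the compact part of the time scale in one period. *)
Lemma periodic_bounded f : {within TS, continuous f} -> periodic_on T TS f ->
  bounded_fct (fun s => f (floor_ts s)).
Proof.
move=> fc fT; pose K := TS `&` [set` `[0, T]].
have Kc : compact K.
  apply: (@subclosed_compact _ _ [set` `[0, T]]) => [||x []//].
    by apply: closedI => //; apply: interval_closed.
  exact: segment_compact.
have fK : {within K, continuous f} by apply: continuous_subspaceW fc => x [].
have [M [_ Mf]] := compact_bounded (continuous_compact fK Kc).
exists (M + 1) => s; pose z := Num.floor (floor_ts s / T).
have fs := floor_ts_in s.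
rewrite -(periodic_on_shift (- z) fT fs).
apply: (Mf (M + 1)); first by rewrite ltrDl.
exists (floor_ts s + (- z)%:~R * T) => //; split; first exact: ts_shift.
rewrite /= in_itv /= mulrNz mulNr subr_ge0 -ler_pdivlMr // floor_le /=.
rewrite lerBlDr -{1}[T]mul1r -mulrDl -ler_pdivrMr // addrC.
by have := floorD1_gt (floor_ts s / T); rewrite intrD => /ltW.
Qed.

(** Two antiderivatives have the same increments, so the choice made by
    [delta_integral] does not matter. *)
Lemma delta_integralE f : {within TS, continuous f} -> periodic_on T TS f ->
  delta_integral TS f 0 T = prim T (fun s => f (floor_ts s)) T.
Proof.
move=> fc fT; set F := prim T _.
have fb := periodic_bounded fc fT.
have flc : {within TS, continuous (fun s => f (floor_ts s))}.
  by apply: within_continuous_ext fc => t /floor_ts_id ->.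
have dF : is_delta_antiderivative TS F f.
  move=> t tTS; rewrite -{2}(floor_ts_id tTS).
  by apply: is_delta_deriv_prim => // u; rewrite floor_tsK.
rewrite /delta_integral; case: xgetP => [v _ [G dG ->]|/(_ (F T - F 0))[]].
  have TST : TS T by rewrite -[T]add0r; apply: ts_addT.
  have : G 0 - F 0 = G T - F T.
    apply: (@delta_deriv0_constant (fun t => G t - F t)) => // [|t tTS].
      exact: ltW.
    by rewrite -(subrr (f t)); apply: is_delta_derivB; [apply: dG|apply: dF].
  by rewrite {1}/F prim0; lra.
by exists F.
Qed.

End TimeScale.

(** * Uniform continuity and uniform convergence *)

Section RealFunctions.
Variable R : realType.
Implicit Types (f h u : R -> R) (e X M : R).

Lemma continuous_bounded_on h X : continuous h ->
  exists M, 0 <= M /\ forall x, `|x| <= X -> `|h x| <= M.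
Proof.
move=> hc; have hK := continuous_subspaceT (A := [set` `[- X, X]]) hc.
have [M [_ Mf]] := compact_bounded (continuous_compact hK (@segment_compact R (- X) X)).
exists (`|M| + 1); split => [|x xX]; first by rewrite addr_ge0.
apply: Mf; first by rewrite (le_lt_trans (ler_norm _)) // ltrDl.
by exists x => //; rewrite /= in_itv /= -ler_norml.
Qed.

(** Two sequences at vanishing distance that violate the estimate would have
    the same limit along the ultrafilter. *)
Lemma heine h X e : continuous h -> 0 < e ->
  exists2 d, 0 < d & forall x y, `|x| <= X -> `|y| <= X -> `|x - y| <= d ->
    `|h x - h y| <= e.
Proof.
move=> hc e0; apply: contrapT => N.
have /choice[x_ /choice[y_ xy]] : forall n, exists x y : R,
    [/\ `|x| <= X, `|y| <= X, `|x - y| <= n.+1%:R^-1 & e < `|h x - h y|].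
  move=> n; apply: contrapT => Nn; apply: N; exists n.+1%:R^-1 => //.
  move=> x y xX yX xy; rewrite leNgt; apply/negP => exy; apply: Nn.
  by exists x, y.
have xc : x_ n @[n --> U] --> ulim x_.
  by apply: (@ulim_cvg _ _ X); near=> n; case: (xy n).
have yc : y_ n @[n --> U] --> ulim x_.
  apply: (@cvg_ultra_small _ _ _ _ 1 xc) => n.
  by rewrite div1r distrC; case: (xy n).
have hx : h (x_ n) @[n --> U] --> h (ulim x_) by apply: continuous_cvg; [exact: hc|].
have hy : h (y_ n) @[n --> U] --> h (ulim x_) by apply: continuous_cvg; [exact: hc|].
have : e <= `|h (ulim x_) - h (ulim x_)|.
  apply: ulim_ge_cst (cvg_norm (cvgB hx hy)) _.
  by near=> n; case: (xy n) => _ _ _ /ltW.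
by rewrite subrr normr0 leNgt e0.
Unshelve. all: by end_near.
Qed.

Lemma lipschitz_continuous f M :
  (forall s t, `|f s - f t| <= M * `|s - t|) -> continuous f.
Proof.
move=> fM t; apply/cvgrPdistC_le => e e0.
have k0 : 0 < `|M| + 1 by rewrite ltr_wpDl.
near=> s; apply: le_trans (fM s t) _.
apply: le_trans (_ : (`|M| + 1) * `|s - t| <= _).
  by rewrite ler_wpM2r // (le_trans (ler_norm _)) // lerDl.
rewrite -ler_pdivlMl // mulrC distrC; near: s.
by apply: cvgr_dist_le; [exact: cvg_id|rewrite divr_gt0].
Unshelve. all: by end_near.
Qed.

End RealFunctions.

Section UniformConvergence.
Variables (R : realType) (S : Type).
Implicit Types (u v : S -> R).

Lemma uniform_cvg_comp (h : R -> R) X (u_ : nat -> S -> R) u : continuous h ->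
  (forall n s, `|u_ n s| <= X) -> (forall s, `|u s| <= X) ->
  uniform_cvg u_ u -> uniform_cvg (fun n s => h (u_ n s)) (fun s => h (u s)).
Proof.
move=> hc unX uX uu e e0; have [d d0 dP] := heine X hc e0.
by apply: filterS (uu d d0) => n Hn s; apply: dP.
Qed.

Lemma uniform_cvgB (u_ v_ : nat -> S -> R) u v : uniform_cvg u_ u -> uniform_cvg v_ v ->
  uniform_cvg (fun n s => u_ n s - v_ n s) (fun s => u s - v s).
Proof.
move=> uu vv e e0; have e20 : 0 < e / 2 by rewrite divr_gt0.
apply: filterS2 (uu _ e20) (vv _ e20) => n un vn s.
by move: (un s) (vn s); rewrite !ler_norml; lra.
Qed.

Lemma uniform_cvgM X (u_ v_ : nat -> S -> R) u v : (forall n s, `|u_ n s| <= X) ->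
  (forall s, `|v s| <= X) -> uniform_cvg u_ u -> uniform_cvg v_ v ->
  uniform_cvg (fun n s => u_ n s * v_ n s) (fun s => u s * v s).
Proof.
move=> uX vX uu vv e e0.
have k0 : 0 < 2 * (`|X| + 1) by rewrite mulr_gt0 // ltr_wpDl.
have d0 : 0 < e / (2 * (`|X| + 1)) by rewrite divr_gt0.
apply: filterS2 (uu _ d0) (vv _ d0) => n un vn s.
have XX : X <= `|X| + 1 by rewrite (le_trans (ler_norm _)) // lerDl.
have -> : u_ n s * v_ n s - u s * v s =
  u_ n s * (v_ n s - v s) + v s * (u_ n s - u s) by ring.
apply: le_trans (ler_normD _ _) _; rewrite !normrM.
have E : e = (`|X| + 1) * (e / (2 * (`|X| + 1))) +
             (`|X| + 1) * (e / (2 * (`|X| + 1))).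
  by field; rewrite gt_eqF // ltr_wpDl.
rewrite [leRHS]E lerD // ler_pM //.
- by apply: le_trans (uX n s) XX.
- by apply: le_trans (vX s) XX.
Qed.

Lemma uniform_cvg_reindex S' (k : S' -> S) (u_ : nat -> S -> R) u : uniform_cvg u_ u ->
  uniform_cvg (fun n s => u_ n (k s)) (fun s => u (k s)).
Proof. by move=> uu e e0; apply: filterS (uu e e0) => n Hn s; apply: Hn. Qed.

Lemma uniform_cvg_cvg (u_ : nat -> S -> R) u s : uniform_cvg u_ u -> u_ n s @[n --> U] --> u s.
Proof.
move=> uu; apply/cvgrPdistC_le => e e0.
by apply: filterS (uu e e0) => n; apply.
Qed.

End UniformConvergence.

Section Phase.
Variables (R : realType) (T : R).
Hypothesis T0 : 0 < T.
Implicit Types (f : R -> R) (s t : R).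

(** The representative of t modulo T in [0, T). *)
Definition phase t := t - (Num.floor (t / T))%:~R * T.

Lemma phase_itv t : 0 <= phase t < T.
Proof.
rewrite /phase subr_ge0 -ler_pdivlMr // floor_le /=.
rewrite ltrBlDr -{1}[T]mul1r -mulrDl -ltr_pdivrMr // addrC.
by have := floorD1_gt (t / T); rewrite intrD.
Qed.

Lemma phase_id t : 0 <= t < T -> phase t = t.
Proof.
move=> /andP[t0 tT]; rewrite /phase (_ : Num.floor _ = 0) ?mul0r ?subr0 //.
apply/eqP; rewrite floor_eq /= divr_ge0 ?(ltW T0) //=.
by rewrite ltr_pdivrMr // mul1r.
Qed.

Lemma phase_shift t : phase (t + T) = phase t.
Proof.
have E : (t + T) / T = t / T + 1 by field; rewrite gt_eqF.
by rewrite /phase E floorDrz ?int_num1 // floor1 intrD; ring.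
Qed.

Lemma periodic_phase f t : (forall s, f (s + T) = f s) -> f (phase t) = f t.
Proof.
move=> fT; have per : periodic_time_scale T [set: R].
  by apply/seteqP; split => // s _; exists (s - T); rewrite ?subrK.
rewrite /phase -mulNr -mulrNz.
exact: (periodic_on_shift (TS := [set: R]) per).
Qed.

Lemma prim_uniform_cvg (w_ : nat -> R -> R) (w : R -> R) :
  (forall n, bounded_fct (w_ n)) -> bounded_fct w -> uniform_cvg w_ w ->
  forall e, 0 < e ->
  \forall n \near U, forall t, 0 <= t <= T -> `|prim T (w_ n) t - prim T w t| <= e.
Proof.
move=> wnb wb ww e e0; have eT : 0 < e / T by rewrite divr_gt0.
apply: filterS (ww _ eT) => n Hn t /andP[t0 tT].
have := prim_dist T0 (wnb n) wb t0 (fun u _ => Hn u).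
rewrite !prim0 // !subr0 => /le_trans; apply.
by rewrite mulrAC ler_pdivrMr // ler_pM2l.
Qed.

End Phase.

(** * The fixed-point operator *)

Section Operator.
Variables (R : realType) (T r a : R) (TS : set R) (psi h g p : R -> R).
Variables (al ar e : R).
Hypothesis T0 : 0 < T.
Hypothesis TSc : closed TS.
Hypothesis TSper : periodic_time_scale T TS.
Hypothesis TS0 : TS 0.
Hypothesis psi_cont : continuous psi.
Hypothesis psi_lt : forall y, `|psi y| < a.
Hypothesis h_cont : continuous h.
Hypothesis g_cont : continuous g.
Hypothesis p_cont : {within TS, continuous p}.
Hypothesis p_per : periodic_on T TS p.
Hypothesis lt_al_ar : al < ar.
Implicit Types (v : R -> R) (c s t : R).

Local Notation fl := (floor_ts TS).

(** The function psi(v) on the time scale, repeated with period T and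
    constant on the gaps: the delta derivative of the trajectory, up to its
    mean. *)
Definition slope v s := psi (v (phase T (fl s))).

(** Subtracting the mean slope makes the trajectory periodic even when v does
    not satisfy the corresponding condition, and clamping c keeps all
    trajectories bounded; both corrections disappear at a fixed point. *)
Definition traj v c t :=
  clamp al ar c + (prim T (slope v) t - t / T * prim T (slope v) T).

(** The delta derivative that the equation prescribes for v. *)
Definition force v c s :=
  p (fl s) - h (traj v c (fl s)) * slope v s - g (traj v c (fl s - r)).

Lemma a_gt0 : 0 < a.
Proof. exact: le_lt_trans (psi_lt 0). Qed.

Lemma slope_le v s : `|slope v s| <= a.
Proof. exact/ltW/psi_lt. Qed.

Lemma slope_bounded v : bounded_fct (slope v).
Proof. by exists a; apply: slope_le. Qed.

Lemma slope_shift v s : slope v (s + T) = slope v s.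
Proof. by rewrite /slope (floor_ts_shift T0 TSc TSper TS0) phase_shift. Qed.

Lemma traj_shift v c t : traj v c (t + T) = traj v c t.
Proof.
rewrite /traj (prim_shift T0 _ (slope_bounded v) (slope_shift v)).
by field; rewrite gt_eqF.
Qed.

Lemma clamp_le c : `|clamp al ar c| <= `|al| + `|ar|.
Proof.
have /andP[] := clamp_itv c (ltW lt_al_ar).
have := ler_norm (- al); have := ler_norm ar; rewrite normrN.
have := normr_ge0 al; have := normr_ge0 ar.
by rewrite ler_norml; lra.
Qed.

Definition traj_radius := `|al| + `|ar| + (a * T + a * T).

Lemma prim_slope_le v t : 0 <= t <= T -> `|prim T (slope v) t| <= a * T.
Proof.
move=> /andP[t0 tT]; have := prim_lipschitz T0 0 t (slope_le v).
rewrite prim0 // !subr0 (ger0_norm t0) => /le_trans; apply.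
by rewrite ler_pM2l // a_gt0.
Qed.

Lemma traj_le v c t : `|traj v c t| <= traj_radius.
Proof.
rewrite -(periodic_phase t (traj_shift v c)).
have /andP[t0 tT] := phase_itv T0 t; move: (phase T t) t0 tT => {}t t0 tT.
rewrite (le_trans (ler_normD _ _)) // lerD ?clamp_le //.
rewrite (le_trans (ler_normB _ _)) // lerD ?prim_slope_le ?t0 ?(ltW tT) //.
have tT0 : 0 <= t / T by rewrite divr_ge0 // ltW.
rewrite normrM (ger0_norm tT0) -[leRHS]mul1r ler_pM //.
  by rewrite ler_pdivrMr // mul1r ltW.
by rewrite prim_slope_le // lexx andbT ltW.
Qed.

Lemma force_shift v c s : force v c (s + T) = force v c s.
Proof.
rewrite /force slope_shift (floor_ts_shift T0 TSc TSper TS0) p_per; last first.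
  exact: floor_ts_in T0 TSc TSper TS0 _.
by rewrite [fl s + T - r]addrAC !traj_shift.
Qed.

Lemma force_bounded_unif : exists2 Q, 0 < Q & forall v c s, `|force v c s| <= Q.
Proof.
have [P pP] := periodic_bounded T0 TSc TSper TS0 p_cont p_per.
have [H [H0 hH]] := continuous_bounded_on traj_radius h_cont.
have [G [G0 gG]] := continuous_bounded_on traj_radius g_cont.
have P0 : 0 <= P by apply: le_trans (pP 0).
exists (P + H * a + G + 1) => [|v c s].
  by have := mulr_ge0 H0 (ltW a_gt0); lra.
have HH : `|h (traj v c (fl s)) * slope v s| <= H * a.
  rewrite normrM ler_pM ?slope_le //; exact/hH/traj_le.
have GG : `|g (traj v c (fl s - r))| <= G by exact/gG/traj_le.
by move: (pP s) HH GG; rewrite /force !ler_norml; lra.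
Qed.

Variable Q : R.
Hypothesis Q0 : 0 < Q.
Hypothesis force_le : forall v c s, `|force v c s| <= Q.

Lemma force_bounded v c : bounded_fct (force v c).
Proof. by exists Q. Qed.

(** A function on [option R] encodes a pair (v, c): c is the value at None
    and v is the restriction to R. The two conditions for periodicity appear
    as clamped displacements of v(0) and of c, the sign of e deciding which
    way c is pushed. *)
Definition step (u : option R -> R) (o : option R) : R :=
  let v t := u (Some t) in
  match o with
  | None => clamp al ar (u None - e * prim T (force v (u None)) T)
  | Some t =>
      clamp (- (Q * T)) (Q * T) (u (Some 0) - prim T (slope v) T)
        + prim T (force v (u None)) (phase T t)
  end.

Definition step_radius := Q * T + Q * T + (`|al| + `|ar|) + 1.

Let QT0 : 0 < Q * T. Proof. exact: mulr_gt0. Qed.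

Lemma step_radius_gt0 : 0 < step_radius.
Proof.
by rewrite /step_radius; have := normr_ge0 al; have := normr_ge0 ar;
  move: QT0; lra.
Qed.

Lemma prim_force_le v c t : 0 <= t <= T -> `|prim T (force v c) t| <= Q * T.
Proof.
move=> /andP[t0 tT]; have := prim_lipschitz T0 0 t (force_le v c).
rewrite prim0 // !subr0 (ger0_norm t0) => /le_trans; apply.
by rewrite ler_pM2l.
Qed.

Lemma step_le u o : `|step u o| <= step_radius.
Proof.
have := normr_ge0 al; have := normr_ge0 ar; have QT := QT0.
rewrite /step_radius; case: o => [t|] /=; last first.
  by have := clamp_le (u None - e * prim T (force (fun t => u (Some t)) (u None)) T); lra.
have /andP[t0 /ltW tT] := phase_itv T0 t.
have tTT : 0 <= phase T t <= T by rewrite t0.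
have := prim_force_le (fun t => u (Some t)) (u None) tTT.
move: (prim T _ (phase T t)) => x.
have QQ : - (Q * T) <= Q * T by lra.
have /andP[] :=
  clamp_itv (u (Some 0) - prim T (slope (fun t => u (Some t))) T) QQ.
move: (clamp _ _ _) => y.
by rewrite !ler_norml; lra.
Qed.

Lemma uniform_cvg_slope (B : R) (v_ : nat -> R -> R) v :
  (forall n t, `|v_ n t| <= B) -> (forall t, `|v t| <= B) ->
  uniform_cvg v_ v -> uniform_cvg (fun n => slope (v_ n)) (slope v).
Proof.
move=> vnB vB vv; apply: (uniform_cvg_comp (X := B) psi_cont).
- by move=> n s; apply: vnB.
- by move=> s; apply: vB.
exact: (uniform_cvg_reindex (fun s => phase T (fl s)) vv).
Qed.

Lemma uniform_cvg_traj (v_ : nat -> R -> R) v (c_ : nat -> R) c :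
  uniform_cvg (fun n => slope (v_ n)) (slope v) -> c_ n @[n --> U] --> c ->
  uniform_cvg (fun n => traj (v_ n) (c_ n)) (traj v c).
Proof.
move=> ww cc k k0; have k30 : 0 < k / 3 by rewrite divr_gt0.
have /cvgrPdistC_le/(_ _ k30) :
    clamp al ar (c_ n) @[n --> U] --> clamp al ar c by exact: cvg_clamp.
have := prim_uniform_cvg T0 (fun n => slope_bounded (v_ n)) (slope_bounded v) ww k30.
apply: filterS2 => n Hp Hc t.
rewrite -(periodic_phase t (traj_shift (v_ n) (c_ n))).
rewrite -(periodic_phase t (traj_shift v c)).
have /andP[t0 /ltW tT] := phase_itv T0 t; move: (phase T t) t0 tT => {}t t0 tT.
have tTT : 0 <= t <= T by rewrite t0.
have TTT : 0 <= T <= T by rewrite lexx andbT ltW.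
have := Hp t tTT; have := Hp T TTT; rewrite /traj.
move: (prim T _ t) (prim T _ T) (prim T _ t) (prim T _ T) => x y x' y' Hy Hx.
have {}Hy : `|t / T * (y' - y)| <= k / 3.
  have tT0 : 0 <= t / T by rewrite divr_ge0 // ltW.
  rewrite normrM (ger0_norm tT0) -[leRHS]mul1r ler_pM //.
  by rewrite ler_pdivrMr // mul1r.
by move: Hc Hx Hy; rewrite mulrBr !ler_norml; lra.
Qed.

Lemma uniform_cvg_force (v_ : nat -> R -> R) v (c_ : nat -> R) c :
  uniform_cvg (fun n => slope (v_ n)) (slope v) -> c_ n @[n --> U] --> c ->
  uniform_cvg (fun n => force (v_ n) (c_ n)) (force v c).
Proof.
move=> ww cc; have xx := uniform_cvg_traj ww cc.
have [H [H0 hH]] := continuous_bounded_on traj_radius h_cont.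
have comp (k : R -> R) (kc : continuous k) : uniform_cvg
    (fun n s => k (traj (v_ n) (c_ n) s)) (fun s => k (traj v c s)).
  by apply: (uniform_cvg_comp (X := traj_radius) kc _ _ xx) => *; apply: traj_le.
apply: uniform_cvgB; last first.
  exact: (uniform_cvg_reindex (fun s => fl s - r) (comp g g_cont)).
apply: uniform_cvgB.
  by move=> k k0; near=> n => s; rewrite subrr normr0 ltW.
apply: (@uniform_cvgM _ _ (Num.max H a)) ww.
- by move=> n s; rewrite le_max hH //; apply: traj_le.
- by move=> s; rewrite le_max slope_le orbT.
exact: (uniform_cvg_reindex fl (comp h h_cont)).
Unshelve. all: by end_near.
Qed.

Lemma step_continuous (u_ : nat -> option R -> R) u :
  (forall n, bounded_by step_radius (u_ n)) -> bounded_by step_radius u ->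
  uniform_cvg u_ u -> forall o, step (u_ n) o @[n --> U] --> step u o.
Proof.
move=> unB uB uu o.
have ww : uniform_cvg (fun n => slope (fun t => u_ n (Some t)))
                      (slope (fun t => u (Some t))).
  apply: (@uniform_cvg_slope step_radius) => [n t|t|]; rewrite ?unB ?uB //.
  exact: (uniform_cvg_reindex (@Some R) uu).
have cc : u_ n None @[n --> U] --> u None by exact: uniform_cvg_cvg.
have qq := uniform_cvg_force ww cc.
have prim_cc (f_ : nat -> R -> R) f t : (forall n, bounded_fct (f_ n)) ->
    bounded_fct f -> uniform_cvg f_ f -> 0 <= t <= T ->
    prim T (f_ n) t @[n --> U] --> prim T f t.
  move=> fnb fb ff tT; apply/cvgrPdistC_le => k k0.
  by have := prim_uniform_cvg T0 fnb fb ff k0; apply: filterS => n; apply.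
have TTT : 0 <= T <= T by rewrite lexx andbT ltW.
case: o => [t|] /=.
  apply: cvgD; last first.
    have /andP[t0 /ltW tT] := phase_itv T0 t.
    apply: prim_cc; rewrite ?t0 // => *; exact: force_bounded.
  apply: cvg_clamp; apply: cvgB; first exact: (@uniform_cvg_cvg _ _ u_ u).
  apply: prim_cc => // *; exact: slope_bounded.
apply: cvg_clamp; apply: cvgB => //; apply: cvgMr.
apply: prim_cc => // *; exact: force_bounded.
Qed.

(** The values of the operator are Lipschitz with constant Q over a period,
    so a subdivision of mesh d with Q * d <= k suffices. *)
Lemma step_finite_net : finite_net step_radius step.
Proof.
move=> k k0.
pose m := Num.truncn (Q * T / k); pose d := T / m.+1%:R.
have d0 : 0 < d by rewrite divr_gt0.
have Qd : Q * d <= k.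
  rewrite /d mulrA ler_pdivrMr // [k * _]mulrC -ler_pdivrMr //.
  exact/ltW/truncnS_gt.
pose idx t := Num.truncn (phase T t / d).
have idx_itv t : (idx t)%:R * d <= phase T t < (idx t)%:R * d + d.
  have /andP[w0 _] := phase_itv T0 t.
  have /truncn_itv := divr_ge0 w0 (ltW d0); rewrite -/(idx t).
  rewrite ler_pdivlMr // ltr_pdivrMr // => /andP[-> /=].
  by rewrite -natr1 mulrDl mul1r.
have idx_lt t : (idx t < m.+1)%N.
  rewrite -(ltr_nat R) -(ltr_pM2r d0); have /andP[le_w _] := idx_itv t.
  apply: le_lt_trans le_w _; have /andP[_] := phase_itv T0 t.
  by rewrite /d mulrC divfK // pnatr_eq0.
exists (option 'I_m.+1).
exists (fun o => omap (fun t => Ordinal (idx_lt t)) o).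
exists (fun o => omap (fun i : 'I_m.+1 => i%:R * d) o).
move=> u _ [t|] /=; last by rewrite subrr normr0 ltW.
have /andP[lt_t t_lt] := idx_itv t; have /andP[w0 wT] := phase_itv T0 t.
rewrite [phase T (_ * d)]phase_id //; last first.
  apply/andP; split; last exact: le_lt_trans lt_t wT.
  by rewrite mulr_ge0 // ltW.
rewrite opprD addrACA subrr add0r; apply: le_trans Qd.
apply: le_trans (prim_lipschitz T0 _ _ (force_le _ _)) _.
by rewrite ler_pM2l // ler_norml; lra.
Qed.

Lemma step_fixed_point : exists u, forall o, step u o = u o.
Proof.
have [u _ fu] := schauder step_radius_gt0 (fun u _ => step_le u)
  step_finite_net step_continuous.
by exists u.
Qed.

End Operator.

(** * Periodic functions with bounded slope *)

Section Transport.
Variables (R : realType) (T : R) (TS : set R) (x w : R -> R) (b : R).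
Hypothesis T0 : 0 < T.
Hypothesis TSc : closed TS.
Hypothesis TSper : periodic_time_scale T TS.
Hypothesis TS0 : TS 0.
Local Notation fl := (floor_ts TS).
Hypothesis w_le : forall s, `|w s| <= b.
Hypothesis xE : forall t, x t = x 0 + prim T w t.
Hypothesis xT : forall t, x (t + T) = x t.
Implicit Types (s t u k : R).

Lemma transport_w_bounded : bounded_fct w.
Proof. by exists b. Qed.

Lemma transport_incr s t : x t - x s = prim T w t - prim T w s.
Proof. by rewrite (xE t) (xE s); ring. Qed.

Lemma transport_lipschitz s t : `|x s - x t| <= b * `|s - t|.
Proof. by rewrite transport_incr prim_lipschitz. Qed.

(** Within a period the value at t is reached from x 0 in time t and left for
    x 0 in time T - t; the smaller of the two is at most T / 2. *)
Lemma transport_oscillation t : `|x t - x 0| <= b * T / 2.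
Proof.
rewrite -(periodic_phase t xT).
have /andP[t0 tT] := phase_itv T0 t; move: (phase T t) t0 tT => {}t t0 tT.
have := transport_lipschitz t 0; have := transport_lipschitz T t.
rewrite -{1}[T]add0r xT subr0 (ger0_norm t0) (ger0_norm (_ : 0 <= T - t)).
  by rewrite !ler_norml mulrBr; lra.
by rewrite subr_ge0 ltW.
Qed.

(** With F the primitive of f, the difference D of the integral of f(x) w and
    of F(x) is nondecreasing on the time scale: over a short step from t the
    integral of f(x) w is close to f(x t) times the increment of x, and it is
    equal to it over a gap, and that product bounds the increment of F(x) by
    concavity. Since x is periodic, F(x) contributes nothing over a period. *)
Lemma transport_ge0 (f : R -> R) : continuous f -> bounded_fct f ->
  {homo f : y z /~ y <= z} -> 0 <= prim T (fun s => f (x (fl s)) * w s) T.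
Proof.
move=> fc fb fd; set F := (X in prim T X).
have wb := transport_w_bounded.
have fxb : bounded_fct (fun s => f (x (fl s))).
  by have [M fM] := fb; exists M.
have Fb : bounded_fct F by exact: boundedM.
have xc : continuous x := lipschitz_continuous transport_lipschitz.
pose D t := prim T F t - prim T f (x t).
have incr t s k : TS t -> t <= s ->
    (forall u, t <= u < s -> `|F u - f (x t) * w u| <= k) ->
    D t - k * (s - t) <= D s.
  move=> tTS ts Fk; have := prim_dist T0 Fb (boundedZ (f (x t)) wb) ts Fk.
  rewrite !primZ // -mulrBr -transport_incr.
  have := concave_prim T0 (x t) (x s) fb fd.
  by rewrite /D ler_norml; lra.
have Dc : continuous D.
  have [M FM] := Fb; have [N fN] := fb.
  apply: (@lipschitz_continuous _ _ (M + N * b)) => s t.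
  have N0 : 0 <= N by apply: le_trans (fN 0).
  have -> : D s - D t = (prim T F s - prim T F t) -
    (prim T f (x s) - prim T f (x t)) by rewrite /D; ring.
  rewrite (le_trans (ler_normB _ _)) // mulrDl lerD ?prim_lipschitz //.
  apply: le_trans (prim_lipschitz T0 _ _ fN) _.
  by rewrite -mulrA ler_wpM2l // transport_lipschitz.
have : D 0 <= D T.
  have TST : TS T by rewrite -[T]add0r; apply: ts_addT.
  apply: (ts_nondecreasing T0 TSc TSper TS0 TS0 TST (ltW T0)).
  - exact: continuous_subspaceT.
  - move=> t tTS _ tlt.
    have := @incr t (forward_jump TS t) 0 tTS (ltW tlt).
    rewrite mul0r subr0; apply => u /andP[tu us].
    have -> : F u = f (x t) * w u; last by rewrite subrr normr0.
    rewrite /F; congr (f (x _) * _); apply/le_anti.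
    rewrite (floor_ts_ge T0 TSper TS0) // andbT leNgt; apply/negP => tf.
    have := sigma_le T0 TSper TS0 (floor_ts_in T0 TSc TSper TS0 u) tf.
    by have := floor_ts_le T0 TSper TS0 u; lra.
  move=> t tTS _ _ k k0.
  have b0 : 0 <= b by apply: le_trans (w_le 0).
  have b1 : 0 < b + 1 by rewrite ltr_wpDl.
  have fxc : {for t, continuous (f \o x)}.
    by apply: continuous_comp; [exact: xc|exact: fc].
  have /cvgrPdistC_le/(_ (k / (b + 1)) (divr_gt0 k0 b1)) := fxc.
  move=> /nbhs_ballP[d /= d0 dP]; exists d => // s sTS /andP[ts sd].
  apply: incr => // [|u /andP[tu us]]; first exact: ltW.
  have fu := floor_ts_le T0 TSper TS0 u.
  have tf := floor_ts_ge T0 TSper TS0 tTS tu.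
  rewrite /F -mulrBl normrM.
  have H : `|f (x (fl u)) - f (x t)| <= k / (b + 1).
    by apply: dP; rewrite /ball /= ltr_norml; lra.
  apply: le_trans (ler_pM (normr_ge0 _) (normr_ge0 _) H (w_le u)) _.
  by rewrite mulrAC ler_pdivrMr // ler_pM2l // lerDl.
have xT0 : x T = x 0 by rewrite -{1}[T]add0r xT.
by rewrite /D prim0 // xT0; lra.
Qed.

End Transport.

(** * Existence of a solution between two consecutive values *)

Section Balance.
Variables (R : realType) (T r a b c s : R) (TS : set R) (x w h g p : R -> R).
Hypothesis T0 : 0 < T.
Hypothesis TSc : closed TS.
Hypothesis TSper : periodic_time_scale T TS.
Hypothesis TS0 : TS 0.
Local Notation fl := (floor_ts TS).
Hypothesis w_le : forall t, `|w t| <= b.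
Hypothesis b_lt : b < a.
Hypothesis xE : forall t, x t = c + prim T w t.
Hypothesis xT : forall t, x (t + T) = x t.
Hypothesis h_cont : continuous h.
Hypothesis g_cont : continuous g.
Hypothesis p_bounded : bounded_fct (fun t => p (fl t)).
Hypothesis p_mean : prim T (fun t => p (fl t)) T = 0.
Local Notation itv := `]c - a * T / 2, c + a * T / 2[.
Hypothesis g_sign : forall u, u \in itv -> 0 < s * g u.
Hypothesis h_mono : forall u v, u \in itv -> v \in itv -> u <= v ->
  s * h v <= s * h u.

(** On average p vanishes, s * h(x) w is nonnegative and s * g(x) is at least
    a positive constant. All values of x lie within b * T / 2 of c, so that
    clamping its argument to this closed interval makes s * h nonincreasing
    and bounded on the whole line without changing the integral. *)
Lemma balance_sign :
  s * prim T (fun t => p (fl t) - h (x (fl t)) * w t - g (x (fl t - r))) T < 0.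
Proof.
have b0 : 0 <= b by apply: le_trans (w_le 0).
pose rho := b * T / 2.
have rho0 : 0 <= rho by rewrite /rho divr_ge0 // mulr_ge0 // ltW.
have rho_lt : rho < a * T / 2 by rewrite /rho ltr_pM2r // ltr_pM2r.
have sub_itv y : c - rho <= y <= c + rho -> y \in itv.
  by rewrite in_itv /= => /andP[? ?]; lra.
have lr : c - rho <= c + rho by lra.
have x0 : x 0 = c by rewrite xE prim0 // addr0.
have xE' t : x t = x 0 + prim T w t by rewrite x0.
have x_itv t : c - rho <= x t <= c + rho.
  have := transport_oscillation T0 w_le xE' xT t.
  by rewrite x0 -/rho ler_norml => /andP[]; lra.
pose f y := s * h (clamp (c - rho) (c + rho) y).
have fE t : f (x t) = s * h (x t) by rewrite /f clamp_id.
have bnd (k : R -> R) : continuous k ->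
    exists M, forall y, c - rho <= y <= c + rho -> `|k y| <= M.
  move=> kc; have [M [_ kM]] := continuous_bounded_on (`|c| + rho) kc.
  exists M => y /andP[y1 y2]; apply: kM.
  have := ler_norm c; have := ler_norm (- c); rewrite normrN ler_norml; lra.
have fc : continuous f.
  move=> y; apply: cvgMr; apply: continuous_cvg; first exact: h_cont.
  by apply: cvg_clamp.
have fb : bounded_fct f.
  have [M hM] := bnd h h_cont; exists (`|s| * M) => y.
  by rewrite normrM ler_wpM2l // hM // clamp_itv.
have fd : {homo f : y z /~ y <= z}.
  move=> y z yz; apply: h_mono; try by apply/sub_itv/clamp_itv.
  exact: clamp_mono.
have hw := transport_ge0 T0 TSc TSper TS0 w_le xE' xT fc fb fd.
have wb : bounded_fct w by exists b.
have hb : bounded_fct (fun t => h (x (fl t)) * w t).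
  by apply: boundedM wb; have [M hM] := bnd h h_cont; exists M => t; apply: hM.
have gb : bounded_fct (fun t => g (x (fl t - r))).
  by have [M gM] := bnd g g_cont; exists M => t; apply: gM.
have [y0 y0_itv gmin] : exists2 y0, y0 \in `[c - rho, c + rho] &
    forall y, y \in `[c - rho, c + rho] -> s * g y0 <= s * g y.
  apply: EVT_min => //; apply: continuous_subspaceT => y.
  by apply: cvgMr; apply: g_cont.
have gpos : 0 < s * g y0 * T.
  by rewrite mulr_gt0 // g_sign // sub_itv //; move: y0_itv; rewrite in_itv.
have sg : s * g y0 * T <= s * prim T (fun t => g (x (fl t - r))) T.
  have := prim_mono T0 (bounded_fct_cst (s * g y0)) (boundedZ s gb) (ltW T0) (_ : _).
  rewrite !prim0 // prim_cst // primZ // !subr0; apply => u _.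
  by apply: gmin; rewrite in_itv /= x_itv.
have shw : prim T (fun t => f (x (fl t)) * w t) T =
    s * prim T (fun t => h (x (fl t)) * w t) T.
  rewrite -primZ //; congr (prim T _ T); apply/funext => t.
  by rewrite fE mulrA.
rewrite primB //; last exact: boundedB.
rewrite primB // p_mean; move: hw; rewrite shw.
by move: gpos sg; rewrite sub0r !mulrBr mulrN; lra.
Qed.

End Balance.

Section SolutionBetween.
Variables (R : realType) (T r a : R) (TS : set R) (phi psi h g p : R -> R).
Variables (al ar e : R).
Hypothesis T0 : 0 < T.
Hypothesis TSc : closed TS.
Hypothesis TSper : periodic_time_scale T TS.
Hypothesis TS0 : TS 0.
Hypothesis psi_cont : continuous psi.
Hypothesis psi_lt : forall y, `|psi y| < a.
Hypothesis psi_mono : {homo psi : y z / y <= z}.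
Hypothesis psi0 : psi 0 = 0.
Hypothesis phiK : forall y, phi (psi y) = y.
Hypothesis h_cont : continuous h.
Hypothesis g_cont : continuous g.
Hypothesis p_cont : {within TS, continuous p}.
Hypothesis p_per : periodic_on T TS p.
Hypothesis p_mean : delta_integral TS p 0 T = 0.
Hypothesis lt_al_ar : al < ar.
Hypothesis e0 : e != 0.
Hypothesis gl_sign : forall u, u \in `]al - a * T / 2, al + a * T / 2[ ->
  0 < e * g u.
Hypothesis hl_mono : forall u v, u \in `]al - a * T / 2, al + a * T / 2[ ->
  v \in `]al - a * T / 2, al + a * T / 2[ -> u <= v -> e * h v <= e * h u.
Hypothesis gr_sign : forall u, u \in `]ar - a * T / 2, ar + a * T / 2[ ->
  0 < - e * g u.
Hypothesis hr_mono : forall u v, u \in `]ar - a * T / 2, ar + a * T / 2[ ->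
  v \in `]ar - a * T / 2, ar + a * T / 2[ -> u <= v -> - e * h v <= - e * h u.

Local Notation fl := (floor_ts TS).

(** The fixed point of [step] is first shown to have a periodic x, then to
    satisfy the condition that makes v periodic; the signs at both ends of
    [al, ar] exclude these ends. Regularity follows, as slope and force are
    continuous on the time scale once v is periodic. *)
Lemma periodic_solution_between : exists x : R -> R,
  periodic_solution T r a TS phi h g p x /\ al < x 0 < ar.
Proof.
have [Q Q0 force_le] := force_bounded_unif r T0 TSc TSper TS0 psi_lt h_cont
  g_cont p_cont p_per lt_al_ar.
have [u fu] := step_fixed_point e T0 TSc TSper TS0 psi_cont psi_lt h_cont g_cont
  lt_al_ar Q0 force_le.
pose v t := u (Some t); pose c := u None.
pose w := slope T TS psi v; pose x := traj T TS psi al ar v c.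
pose q := force T r TS psi h g p al ar v c.
have QT0 : 0 < Q * T by rewrite mulr_gt0.
have wb : bounded_fct w := slope_bounded T TS psi_lt v.
have qb : bounded_fct q by exists Q => s; apply: force_le.
have cE : clamp al ar (c + - (e * prim T q T)) = c := fu None.
have vE0 t : clamp (- (Q * T)) (Q * T) (v 0 + - prim T w T) +
  prim T q (phase T t) = v t := fu (Some t).
have phase0 : phase T 0 = 0 by rewrite phase_id // lexx.
have v0E : clamp (- (Q * T)) (Q * T) (v 0 + - prim T w T) = v 0.
  by rewrite -[RHS]vE0 phase0 prim0 // addr0.
have vE t : v t = v 0 + prim T q (phase T t) by rewrite -vE0 v0E.
have prim_q_le t : `|prim T q (phase T t)| <= Q * T.
  have /andP[t0 /ltW tT] := phase_itv T0 t.
  by apply: prim_force_le; rewrite ?t0.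
have QQ : - (Q * T) < Q * T by lra.
have v0_itv : - (Q * T) <= v 0 <= Q * T by rewrite -v0E clamp_itv // ltW.
have prim_w_sign : (forall t, 0 <= v t) -> 0 <= prim T w T.
  move=> v_ge0.
  have w_ge0 s : 0 <= s < T -> 0 <= w s by rewrite -psi0 => _; apply: psi_mono.
  have := prim_mono T0 (bounded_fct_cst 0) wb (ltW T0) w_ge0.
  by rewrite !prim0 // prim_cst // mul0r !subr0.
have prim_w_sign' : (forall t, v t <= 0) -> prim T w T <= 0.
  move=> v_le0.
  have w_le0 s : 0 <= s < T -> w s <= 0 by rewrite -psi0 => _; apply: psi_mono.
  have := prim_mono T0 wb (bounded_fct_cst 0) (ltW T0) w_le0.
  by rewrite !prim0 // prim_cst // mul0r !subr0.
(* at an end of [-QT, QT] all values of v have the sign of that end *)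
have w_mean : prim T w T = 0.
  have [w0|[w0 vQ]|[w0 vQ]] := clamp_fixed QQ v0E.
  - by apply/eqP; rewrite -oppr_eq0 w0.
  - suff : 0 <= prim T w T by lra.
    apply: prim_w_sign => t; rewrite vE vQ.
    by have := prim_q_le t; rewrite ler_norml => /andP[]; lra.
  - suff : prim T w T <= 0 by lra.
    apply: prim_w_sign' => t; rewrite vE vQ.
    by have := prim_q_le t; rewrite ler_norml => /andP[]; lra.
have c_itv : al <= c <= ar by rewrite -cE clamp_itv // ltW.
have xE t : x t = c + prim T w t.
  by rewrite /x /traj -/w w_mean mulr0 subr0 clamp_id.
have xT t : x (t + T) = x t by apply: traj_shift.
(* v takes its values in a compact interval, so the slopes stay away from a *)
pose b := Num.max (psi (Q * T + Q * T)) (- psi (- (Q * T + Q * T))).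
have b_lt : b < a.
  rewrite gt_max; have := psi_lt (Q * T + Q * T); have := psi_lt (- (Q * T + Q * T)).
  by rewrite !ltr_norml; lra.
have w_le t : `|w t| <= b.
  have v_itv s : - (Q * T + Q * T) <= v s <= Q * T + Q * T.
    by have := prim_q_le s; rewrite vE ler_norml; move: v0_itv; lra.
  have /andP[v1 v2] := v_itv (phase T (fl t)).
  rewrite ler_norml lerNl !le_max lerN2.
  by rewrite (psi_mono v1) (psi_mono v2) orbT.
have pb := periodic_bounded T0 TSc TSper TS0 p_cont p_per.
have pm : prim T (fun s => p (fl s)) T = 0.
  by rewrite -(delta_integralE T0 TSc TSper TS0).
have sign_al : c = al -> e * prim T q T < 0.
  move=> cal; apply: (balance_sign r T0 TSc TSper TS0 w_le b_lt xE xT) => //;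
  by rewrite cal.
have sign_ar : c = ar -> - e * prim T q T < 0.
  move=> car; apply: (balance_sign r T0 TSc TSper TS0 w_le b_lt xE xT) => //;
  by rewrite car.
have q_mean : prim T q T = 0.
  have [q0|[q0 /sign_ar]|[q0 /sign_al]] := clamp_fixed lt_al_ar cE; try lra.
  by apply/eqP; move/eqP: q0; rewrite oppr_eq0 mulf_eq0 (negbTE e0).
have qT s : q (s + T) = q s by apply: force_shift.
pose V t := v 0 + prim T q t.
have VT t : V (t + T) = V t by rewrite /V prim_shift // q_mean addr0.
have vV t : v (phase T t) = V t.
  rewrite vE [X in prim T q X]phase_id ?phase_itv //.
  by rewrite -/(V (phase T t)) periodic_phase.
have flK s : fl (fl s) = fl s by apply: floor_tsK T0 TSc TSper TS0 s.
have fl_id t : TS t -> fl t = t by apply: floor_ts_id T0 TSper TS0 t.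
have wE t : w t = psi (V (fl t)) by rewrite /w /slope vV.
have qE t : q t = p (fl t) - h (x (fl t)) * w t - g (x (fl t - r)) by [].
have Vc : continuous V.
  have [M qM] := qb; apply: (@lipschitz_continuous _ _ M) => s t.
  by rewrite /V opprD addrACA subrr add0r prim_lipschitz.
have xc : continuous x.
  apply: (@lipschitz_continuous _ _ b) => s t.
  by rewrite !xE opprD addrACA subrr add0r prim_lipschitz.
have psiVc : continuous (fun t => psi (V t)).
  by move=> t; apply: continuous_comp; [exact: Vc|exact: psi_cont].
have wc : {within TS, continuous w}.
  apply: (within_continuous_ext (f := fun t => psi (V t))); last exact: continuous_subspaceT.
  by move=> t tTS; rewrite wE fl_id.
have qc : {within TS, continuous q}.
  apply: (within_continuous_ext (f := fun t => p t - h (x t) * psi (V t) - g (x (t - r)))).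
    by move=> t tTS; rewrite qE wE fl_id.
  have A : continuous (fun t => h (x t) * psi (V t)).
    move=> t; apply: cvgM; last exact: psiVc.
    by apply: continuous_comp; [exact: xc|exact: h_cont].
  have B : continuous (fun t => g (x (t - r))).
    move=> t; apply: (continuous_comp (f := fun t => x (t - r))); last exact: g_cont.
    apply: (continuous_comp (f := fun t => t - r)); last exact: xc.
    by apply: cvgB; [exact: cvg_id|exact: cvg_cst].
  move=> t; apply: cvgB; first apply: cvgB; first exact: p_cont.
    exact: (continuous_subspaceT A).
  exact: (continuous_subspaceT B).
have x_deriv t : TS t -> is_delta_deriv TS x t (w t).
  move=> tTS.
  have : is_delta_deriv TS (prim T w) t (w t).
    by apply: is_delta_deriv_prim => // s; rewrite !wE flK.
  move=> H k /H[d d0 dP]; exists d => // s sTS /(dP s sTS).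
  by rewrite !xE opprD addrACA subrr add0r.
have V_deriv t : TS t -> is_delta_deriv TS V t (q t).
  move=> tTS.
  have : is_delta_deriv TS (prim T q) t (q t).
    by apply: is_delta_deriv_prim => // s; rewrite !qE !wE flK.
  move=> H k /H[d d0 dP]; exists d => // s sTS /(dP s sTS).
  by rewrite /V opprD addrACA subrr add0r.
have dx t : TS t -> delta_deriv TS x t = w t.
  by move=> tTS; apply: (delta_derivE T0 TSper TS0 tTS) (x_deriv t tTS).
have phi_deriv t : TS t ->
    is_delta_deriv TS (fun s => phi (delta_deriv TS x s)) t (q t).
  move=> tTS; apply: (is_delta_deriv_ext T0 TSc TSper TS0) (V_deriv t tTS) => s sTS.
  by rewrite dx // wE fl_id // phiK.
have dphi t : TS t ->
    delta_deriv TS (fun s => phi (delta_deriv TS x s)) t = q t.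
  by move=> tTS; apply: (delta_derivE T0 TSper TS0 tTS) (phi_deriv t tTS).
exists x; split; last first.
  rewrite xE prim0 // addr0 !lt_neqAle.
  move: c_itv => /andP[-> ->]; rewrite !andbT.
  by apply/andP; split; apply/eqP => ca; [have := sign_al (esym ca)|have := sign_ar ca];
    rewrite q_mean mulr0 ltxx.
split.
- split; first exact: continuous_subspaceT.
    by move=> t _; apply: xT.
  split; first by move=> t tTS; exists (w t); apply: x_deriv.
  by apply: within_continuous_ext wc => t tTS; rewrite dx.
- by move=> t tTS; rewrite dx // wE.
- split; first by move=> t tTS; exists (q t); apply: phi_deriv.
  by apply: within_continuous_ext qc => t tTS; rewrite dphi.
- by move=> t tTS; rewrite dphi // dx // qE fl_id //; ring.
Qed.

End SolutionBetween.

Theorem corollary1p2 (R : realType) (T r a : R) (TS : set R)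
    (phi h g : R -> R) (n : nat) (alpha : 'I_n.+1 -> R)
    (hT : 0 < T) (hr : 0 <= r)
    (hTS : time_scale TS)
    (hTSper : periodic_time_scale T TS)
    (hTSr : [set t - r | t in TS] `<=` TS)
    (hTS0 : TS 0)
    (ha : 0 < a)
    (hphi : increasing_homeomorphism a phi)
    (hphi0 : phi 0 = 0)
    (hh : continuous h) (hg : continuous g)
    (halpha : forall i j : 'I_n.+1, (i < j)%N -> alpha i < alpha j)
    (hgsign : forall (j : 'I_n.+1) (u : R),
       u \in `]alpha j - a * T / 2, alpha j + a * T / 2[ ->
       0 < (-1) ^+ j * g u)
    (hhmono : forall (j : 'I_n.+1) (u v : R),
       u \in `]alpha j - a * T / 2, alpha j + a * T / 2[ ->
       v \in `]alpha j - a * T / 2, alpha j + a * T / 2[ ->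
       u <= v -> (-1) ^+ j * h v <= (-1) ^+ j * h u) :
  forall p : R -> R,
    {within TS, continuous p} -> periodic_on T TS p ->
    T^-1 * delta_integral TS p 0 T = 0 ->
    exists x : 'I_n -> R -> R,
      (forall i, periodic_solution T r a TS phi h g p (x i)) /\
      (forall i j, i != j -> exists2 t, TS t & x i t <> x j t).
Proof.
move=> p p_cont p_per p_mean0.
have p_mean : delta_integral TS p 0 T = 0.
  by move/eqP: p_mean0; rewrite mulf_eq0 invr_eq0 gt_eqF //= => /eqP.
have [_ TSc] := hTS.
have [phi_mono phi_cont [psi [psi_in psiK phiK psi_cont]]] := hphi.
have psi_lt y : `|psi y| < a.
  by have := psi_in y; rewrite in_itv /= ltr_norml.
have psi_mono : {homo psi : y z / y <= z}.
  move=> y z yz; rewrite leNgt; apply/negP => /(phi_mono _ _ (psi_in z) (psi_in y)).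
  by rewrite !phiK ltNge yz.
have psi0 : psi 0 = 0.
  by rewrite -{1}hphi0 psiK // in_itv /= oppr_lt0 ha.
have /choice[x xP] : forall i : 'I_n, exists x : R -> R,
    periodic_solution T r a TS phi h g p x /\
    alpha (widen_ord (leqnSn n) i) < x 0 < alpha (lift ord0 i).
  move=> i; apply: (@periodic_solution_between R T r a TS phi psi h g p
      (alpha (widen_ord (leqnSn n) i)) (alpha (lift ord0 i)) ((-1) ^+ i)) => //.
  - by apply: halpha; rewrite /= /bump.
  - by rewrite signr_eq0.
  - exact: hgsign.
  - exact: hhmono.
  - move=> u /hgsign; rewrite /= /bump /= add1n exprS mulN1r //.
  - move=> u v uI vI uv; have := hhmono _ _ _ uI vI uv.
    by rewrite /= /bump /= add1n exprS mulN1r.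
exists x; split => [i|i j]; first by case: (xP i).
have x_lt (k l : 'I_n) : (k < l)%N -> x k 0 < x l 0.
  move=> kl; have [_ /andP[_ xk]] := xP k; have [_ /andP[xl _]] := xP l.
  apply: lt_trans xk (le_lt_trans _ xl).
  have [->//|kl'] := eqVneq (lift ord0 k) (widen_ord (leqnSn n) l).
  apply/ltW/halpha; rewrite ltn_neqAle; apply/andP; split.
    by apply: contraNneq kl' => /val_inj ->.
  by rewrite /= /bump /= add1n.
move=> ij; exists 0 => //.
have : (i < j)%N || (j < i)%N by rewrite -neq_ltn.
by case/orP => /x_lt; [move=> + ijE|move=> + ijE]; rewrite ijE ltxx.
Qed.
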